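(* Let $k_2\ge 3$ be an odd integer. For $1\le m_2\le m_1\le k_2$ let $\mathbf{e}(m_2,m_1)$ be the index of length $k_2$ obtained from $(1,\dots,1)$ by adding $1$ to the entry in position $m_2$ and adding $1$ to the entry in position $m_1$ (so if $m_1=m_2$ that entry equals $3$). Then $$\sum_{m_2=1}^{k_2}\mathbb{G}(k_2,m_2)\sum_{m_1=m_2}^{k_2}\tilde T(\mathbf{e}(m_2,m_1))=\tilde T(1)\,T(1,k_2)+\tilde T(1)\,\tilde T(1,k_2).$$
   Context: Multiple $T$-values: for $\mathbf{k}=(k_1,\dots,k_r)\in\mathbb{Z}_{\ge1}^r$ with $k_r>1$, $T(\mathbf{k})=2^r\sum \frac{1}{m_1^{k_1}\cdots m_r^{k_r}}$, the sum over integers $0<m_1<\cdots<m_r$ with $m_j\equiv j \pmod 2$ for all $j$. Multiple $\tilde T$-values: for $\mathbf{k}=(k_1,\dots,k_r)\in\mathbb{Z}_{\ge1}^r$, $\tilde T(\mathbf{k})=2^r\sum\frac{(-1)^{(m_r-r)/2}}{m_1^{k_1}\cdots m_r^{k_r}}$, the sum over integers $0<m_1<\cdots<m_r$ with $m_j\equiv j\pmod 2$ for all $j$ (when $k_r=1$ the series is understood as the limit as $M\to\infty$ of the partial sums over $m_r\le M$). $\mathbb{G}(k,j)$ is the number of permutations $\sigma\in\mathfrak{S}_{k-1}$ with $\sigma(1)=j$ that are Dumont permutations (of the first kind), i.e. for $1\le i\le k-2$: $\sigma(i)<\sigma(i+1)$ if and only if $\sigma(i)$ is odd (no condition is imposed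 on the last value $\sigma(k-1)$). In particular $\mathbb{G}(k,k)=0$. Example: $\mathbb{G}(5,2)=|\{(2,1,3,4),(2,1,4,3)\}|=2$. *)

(* Defs.v *)
From HB Require Import structures.
From mathcomp Require Import all_boot all_order all_algebra all_fingroup.
From mathcomp Require Import all_classical all_reals all_analysis.
Set Implicit Arguments.
Unset Strict Implicit.
Unset Printing Implicit Defensive.
Import Order.TTheory GRing.Theory Num.Theory.
Import numFieldNormedType.Exports.
Local Open Scope classical_set_scope.
Local Open Scope ring_scope.

(* [m] satisfies 0 < m_1 < ... < m_r and m_j = j mod 2. Tuples and ordinals
   count positions from 0, so position [j] holds m_(j+1). *)
Definition summation_range (r M : nat) (m : r.-tuple 'I_M.+1) : bool :=
  path ltn 0%N [seq val x | x <- m] &&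
  [forall j : 'I_r, (tnth m j == j.+1 %[mod 2])%N].

Definition last_index (r M : nat) (m : r.-tuple 'I_M.+1) : nat :=
  last 0%N [seq val x | x <- m].

Section MultipleTValues.
Variable R : realType.

Definition summand (r M : nat) (k : r.-tuple nat) (m : r.-tuple 'I_M.+1) : R :=
  (\prod_(j < r) (tnth m j)%:R ^+ tnth k j)^-1.

(* Partial sums over m_r <= M. For T all terms are nonnegative, so their limit
   is the sum of the series irrespective of the order of summation. *)
Definition partial_T (r : nat) (k : r.-tuple nat) (M : nat) : R :=
  2 ^+ r * \sum_(m : r.-tuple 'I_M.+1 | summation_range m) summand k m.

(* On the summation range, m_r - r is even and nonnegative, so the truncated
   subtraction and the halving are exact. *)
Definition partial_tildeT (r : nat) (k : r.-tuple nat) (M : nat) : R :=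
  2 ^+ r * \sum_(m : r.-tuple 'I_M.+1 | summation_range m)
    (-1) ^+ (last_index m - r)%N./2 * summand k m.

Definition mtv_T (r : nat) (k : r.-tuple nat) : R :=
  lim (partial_T k M @[M --> \oo]).

Definition mtv_tildeT (r : nat) (k : r.-tuple nat) : R :=
  lim (partial_tildeT k M @[M --> \oo]).

End MultipleTValues.

(* The values of [s : 'S_n] are shifted by one: sigma(i+1) = (s i).+1. *)
Definition dumont (n : nat) (s : 'S_n) : bool :=
  [forall i : 'I_n, forall i' : 'I_n,
     (i' == i.+1 :> nat) ==> ((s i < s i')%N == odd (s i).+1)].

Definition dumont_count (k j : nat) : nat :=
  #|[pred s : 'S_k.-1 | dumont s &&
       [exists i : 'I_k.-1, (i == 0%N :> nat) && ((s i).+1 == j)]]|.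

(* The positions [m2], [m1] are numbered from 1. *)
Definition e_index (k m2 m1 : nat) : k.-tuple nat :=
  [tuple (1 + (i.+1 == m2) + (i.+1 == m1))%N | i < k].

(* Main.v *)
Require Import Defs.
From HB Require Import structures.
From mathcomp Require Import all_boot all_order all_algebra all_fingroup.
From mathcomp Require Import all_classical all_reals all_analysis.
From mathcomp Require Import ring lra zify.
Import Order.TTheory GRing.Theory Num.Theory.
Import numFieldNormedType.Exports.

(** Put z = tan(theta/2), so that dz/z = dtheta/sin(theta) and 2dz/(1+z^2) = dtheta.
    Then tilde T(k) is an iterated integral over [0, pi/2], where each entry k_j of
    the index contributes one form dtheta followed by k_j - 1 forms
    dtheta/sin(theta). By the binomial theorem the left-hand side becomes
      int_0^(pi/2) dtheta/sin(theta) int_0^theta P_n(t) dt/sin(t),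
      P_n(t) = sum_m G(n, m) t^m/m! (pi/2 - t)^(n-m)/(n-m)!,   n = k_2.
    The Dumont numbers satisfy G(n, m+2) - 2 G(n, m+1) + G(n, m) = - G(n-2, m), that
    is P_n'' = - P_(n-2), whence P_n(t) = 4 sum_(j odd) sin(2jt)/(2j)^n; integrating
    this series term by term gives pi/2 (T(1, n) + tilde T(1, n)).
    No integral is actually taken: truncated power series in z satisfy the
    corresponding differential equations up to a controlled error, and are compared
    with truncated Fourier series by the mean value inequality.

    For the recurrence, G(n, m) is a sum of two values of a linear functional on words
    in letters satisfying the relations of a Weyl algebra. Removing the first value of
    a Dumont permutation amounts to commuting one letter out of the word. *)

Set Implicit Arguments.
Unset Strict Implicit.
Unset Printing Implicit Defensive.

(** * Counting Dumont permutations by words in a Weyl algebra *)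

(** A last entry 1 makes tilde T converge only conditionally, so nothing can be dominated at z = 1.
    Cutting a series at degree M leaves in its differential equation an error that is only o(M) z^M;
    it need not be small near z = 1, but its primitive is o(1) z. Errors are therefore estimated
    after integration, and relative to z, so that a further division by z is harmless. On the
    Fourier side the recursion ought to start from the constant P_1 = pi/2, a square wave, whose
    sine series does not converge uniformly near 0; moreover G(1, m) = 0 under the given definition.
    The induction starts at n = 3 instead, where the derivative of the expansion is an absolutely
    convergent cosine series. For the recurrence, no bijection between matchings and Dumont
    permutations is built: both counts obey the same recursion when the first value is removed.
    Permutations are sorted by the parity of the last value, because nothing is required there; for
    a given first value each class corresponds to one word. *)

(* In a word, Gap is a column of a board, and Up (Down) is a row that has to be
   matched with a later (earlier) column. *)
Inductive letter := Gap | Up | Down.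

(* The number of perfect matchings of the rows and columns of w, when u unmatched
   columns and p unmatched Up rows precede w. *)
Fixpoint weyl (u p : nat) (w : seq letter) : nat :=
  match w with
  | [::] => (u == 0) && (p == 0)
  | Gap :: w' => weyl u.+1 p w' + p * weyl u p.-1 w'
  | Up :: w' => weyl u p.+1 w'
  | Down :: w' => u * weyl u.-1 p w'
  end.

Definition ev := weyl 0 0.

(** The last term counts the matchings that pair these two letters with each other; all other
    matchings survive the swap. *)
Lemma weyl_up_gap s t u p :
  weyl u p (s ++ Up :: Gap :: t) = weyl u p (s ++ Gap :: Up :: t) + weyl u p (s ++ t).
Proof.
elim: s u p => [|[] s IH] u p /=; rewrite ?IH; try nia.
by case: p => [|p] /=; nia.
Qed.

Lemma weyl_gap_down s t u p :
  weyl u p (s ++ Gap :: Down :: t) = weyl u p (s ++ Down :: Gap :: t) + weyl u p (s ++ t).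
Proof.
elim: s u p => [|[] s IH] u p /=; rewrite ?IH; try nia.
by case: u => [|u] /=; nia.
Qed.

Lemma weyl_up_down s t u p :
  weyl u p (s ++ Up :: Down :: t) = weyl u p (s ++ Down :: Up :: t).
Proof. by elim: s u p => [|[] s IH] u p /=; rewrite ?IH. Qed.

(** A final [Up] has no later column, just as in [ev_down] an initial [Down] has no earlier one. So
    a row is eliminated by commuting it towards the end where it vanishes: [Up] to the right, [Down]
    to the left. *)
Lemma weyl_up_end s u p : weyl u p (s ++ [:: Up]) = 0.
Proof. by elim: s u p => [|[] s IH] u p /=; rewrite ?IH ?muln0 ?andbF. Qed.

Lemma ev_down s : ev (Down :: s) = 0. Proof. by []. Qed.

(* Values of permutations are numbered from 0: even ones are followed by an ascent. *)
Definition step (v : nat) := if odd v then Down else Up.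
Definition gap_row (s : seq nat) := flatten [seq [:: Gap; step v] | v <- s].
Definition row_gap (s : seq nat) := flatten [seq [:: step v; Gap] | v <- s].

Lemma gap_row_cat s t : gap_row (s ++ t) = gap_row s ++ gap_row t.
Proof. by rewrite /gap_row map_cat flatten_cat. Qed.
Lemma row_gap_cat s t : row_gap (s ++ t) = row_gap s ++ row_gap t.
Proof. by rewrite /row_gap map_cat flatten_cat. Qed.
Lemma gap_row_gap s : gap_row s ++ [:: Gap] = Gap :: row_gap s.
Proof. by elim: s => //= v s ->. Qed.

Lemma stepSS i : step i.+2 = step i. Proof. by rewrite /step /= negbK. Qed.
Lemma row_gap_shift m l : row_gap (iota m.+2 l) = row_gap (iota m l).
Proof.
elim: l m => //= l IH m; rewrite [LHS]/(row_gap _) /= -/(row_gap _) IH stepSS //.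
Qed.
Lemma gap_row_shift m l : gap_row (iota m.+2 l) = gap_row (iota m l).
Proof.
elim: l m => //= l IH m; rewrite [LHS]/(gap_row _) /= -/(gap_row _) IH stepSS //.
Qed.
Lemma row_gap_cons v s : row_gap (v :: s) = step v :: Gap :: row_gap s.
Proof. by []. Qed.
Lemma gap_row_cons v s : gap_row (v :: s) = Gap :: step v :: gap_row s.
Proof. by []. Qed.
Lemma gap_row_rcons v s : gap_row (rcons s v) = gap_row s ++ [:: Gap; step v].
Proof. by rewrite -cats1 gap_row_cat. Qed.
Lemma gap_row_iotaS i : gap_row (iota 0 i.+1) = gap_row (iota 0 i) ++ [:: Gap; step i].
Proof. by rewrite -addn1 iotaD gap_row_cat. Qed.

(** The missing gap moves from behind three consecutive rows to in front of them, and the two short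
    words are what remains when a row and a gap cancel. Rows [i] and [i.+2] are of the same kind, so
    only the parity of [i] matters. *)
Lemma ev_second_difference u v i :
  ev (u ++ [:: Gap; step i; Gap; step i.+1; Gap; step i] ++ v) +
  ev (u ++ [:: step i; Gap; step i.+1; Gap; step i; Gap] ++ v) +
  (ev (u ++ [:: Gap; step i] ++ v) + ev (u ++ [:: step i; Gap] ++ v)) =
  ev (u ++ [:: Gap; step i; Gap; step i.+1; step i; Gap] ++ v) +
  ev (u ++ [:: Gap; step i; step i.+1; Gap; step i; Gap] ++ v).
Proof.
have UG s t := weyl_up_gap (u ++ s) (t ++ v) 0 0.
have GD s t := weyl_gap_down (u ++ s) (t ++ v) 0 0.
have UD s t := weyl_up_down (u ++ s) (t ++ v) 0 0.
rewrite /step /=; case: (odd i) => /=; rewrite /ev.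
- have := GD [:: Gap; Down; Gap; Up] [::].
  have := GD [::] [:: Up; Gap; Down; Gap].
  have := UG [::] [:: Down; Gap].
  have := UD [:: Gap] [:: Gap].
  have := UG [:: Gap; Down] [::].
  by rewrite -!catA /=; lia.
- have := UG [:: Gap; Up; Gap; Down] [::].
  have := UG [::] [:: Down; Gap; Up; Gap].
  have := GD [:: Gap; Up] [::].
  have := UD [:: Gap] [:: Gap].
  have := GD [::] [:: Up; Gap].
  by rewrite -!catA /=; lia.
Qed.

(* The word of L rows alternating Up, Down with the gap at position i removed. *)
Definition qcount (L i : nat) : nat :=
  if i <= L then ev (gap_row (iota 0 i) ++ row_gap (iota i (L - i))) else 0.

Lemma qcountE L i : i <= L ->
  qcount L i = ev (gap_row (iota 0 i) ++ row_gap (iota i (L - i))).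
Proof. by rewrite /qcount => ->. Qed.

(** This third-order relation is the recurrence for the Dumont numbers: by [dumont_countE] they are
    sums of two neighbouring values of [qcount], so adding the right-hand side to both sides
    produces their second difference. *)
Lemma qcount_rec L i : i.+3 <= L.+2 ->
  qcount L.+2 i.+3 + qcount L.+2 i + (qcount L i.+1 + qcount L i)
  = qcount L.+2 i.+2 + qcount L.+2 i.+1.
Proof.
move=> iL; have [l lE] : exists l, L = i + l.+1 by exists (L - i.+1); lia.
rewrite !qcountE; try lia.
have -> : L.+2 - i.+3 = l by lia.
have -> : L.+2 - i.+2 = l.+1 by lia.
have -> : L.+2 - i.+1 = l.+2 by lia.
have -> : L.+2 - i = l.+3 by lia.
have -> : L - i.+1 = l by lia.
have -> : L - i = l.+1 by lia.
rewrite !gap_row_iotaS [iota i l.+3]/= [iota i.+1 l.+2]/= [iota i.+2 l.+1]/= [iota i l.+1]/=.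
rewrite !row_gap_cons (row_gap_shift i.+1 l) stepSS.
have := ev_second_difference (gap_row (iota 0 i)) (row_gap (iota i.+1 l)) i.
by rewrite -!catA.
Qed.

Lemma qcount_start L : qcount L.+2 1 = qcount L.+2 0.
Proof. by []. Qed.

(** Edge cases of [qcount_rec], here and in the next two lemmas, where not all of its words exist.
    What replaces them is the vanishing of words that start with [Down] or end with [Up]. *)
Lemma qcount_second L :
  qcount L.+2 2 + qcount L 0 = qcount L.+2 1 + qcount L.+2 0.
Proof.
rewrite -qcount_start.
rewrite !qcountE // !subn0 !subSS !subn0 [iota 0 1]/= [iota 1 L.+1]/= [iota 0 2]/= !row_gap_cons.
by rewrite !row_gap_shift /ev /=; lia.
Qed.

Lemma qcount_last L : ~~ odd L -> qcount L.+2 L.+2 = qcount L.+2 L.+1.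
Proof.
move=> Leven; rewrite !qcountE // subnn subSnn cats0 2!gap_row_iotaS /= /step /= Leven (negPf Leven) /=.
have /= := weyl_gap_down (gap_row (iota 0 L) ++ [:: Gap; Up]) [::] 0 0.
have /= := weyl_up_end (gap_row (iota 0 L) ++ [:: Gap]) 0 0.
by rewrite -!catA /= /ev /row_gap /= /step /= Leven; lia.
Qed.

Lemma qcount_penultimate L : ~~ odd L ->
  qcount L.+2 L + qcount L L = qcount L.+2 L.+2 + qcount L.+2 L.+1.
Proof.
move=> Leven; rewrite qcount_last // !qcountE; try lia.
have -> : L.+2 - L.+1 = 1 by lia.
rewrite subnn.
have -> : L.+2 - L = 2 by lia.
rewrite cats0 !gap_row_iotaS /=; set u := gap_row _.
have -> : row_gap [:: L; L.+1] = [:: Up; Gap; Down; Gap].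
  by rewrite /row_gap /= /step /= Leven (negPf Leven).
have -> : row_gap [:: L.+1] = [:: Down; Gap] by rewrite /row_gap /= /step /= Leven.
have -> : step L = Up by rewrite /step (negPf Leven).
have := weyl_up_gap u [:: Down; Gap] 0 0.
have := weyl_up_gap u [::] 0 0.
have := weyl_gap_down u [::] 0 0.
have := weyl_up_down (u ++ [:: Gap]) [:: Gap] 0 0.
have := weyl_up_gap (u ++ [:: Gap; Down]) [::] 0 0.
have := weyl_up_end (u ++ [:: Gap; Down; Gap]) 0 0.
have := weyl_up_end (u ++ [:: Gap]) 0 0.
have := weyl_gap_down u [:: Up; Gap] 0 0.
by rewrite -!catA /= /ev !cats0; lia.
Qed.

(** Deleting a letter needs the context on both sides, which a plain sum over [s] does not give; [a]
    accumulates the left context. *)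
Fixpoint split_sum (f : seq nat -> nat -> seq nat -> nat) (a s : seq nat) : nat :=
  if s is v :: c then f a v c + split_sum f (rcons a v) c else 0.

Lemma split_sum_rcons f a s v :
  split_sum f a (rcons s v) = split_sum (fun a x c => f a x (rcons c v)) a s + f (a ++ s) v [::].
Proof. by elim: s a => [|x s IH] a /=; rewrite ?cats0 ?addn0 // IH cat_rcons addnA. Qed.

Lemma eq_split_sum f g a s : (forall b v c, s = b ++ v :: c -> f (a ++ b) v c = g (a ++ b) v c) ->
  split_sum f a s = split_sum g a s.
Proof.
elim: s a => //= x s IH a fg; congr (_ + _); first by rewrite -[a]cats0; apply: (fg [::]).
apply: IH => b v c sE; rewrite cat_rcons; apply: (fg (x :: b)); by rewrite sE.
Qed.

Lemma big_split_sum (F : nat -> nat) f a s :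
  (forall b v c, s = b ++ v :: c -> F v = f (a ++ b) v c) -> \sum_(v <- s) F v = split_sum f a s.
Proof.
elim: s a => [|x s IH] a Ff; first by rewrite big_nil.
rewrite big_cons /=; congr (_ + _); first by rewrite -[a]cats0; apply: (Ff [::]).
apply: IH => b v c sE; rewrite cat_rcons; apply: (Ff (x :: b)); by rewrite sE.
Qed.

Lemma split_sum_cons f a v s :
  split_sum f (v :: a) s = split_sum (fun b => f (v :: b)) a s.
Proof. by elim: s a => //= x s IH a; rewrite IH. Qed.

Lemma split_sum_mul k f a s :
  split_sum (fun b v c => k * f b v c) a s = k * split_sum f a s.
Proof. by elim: s a => /= [|x s IH] a; rewrite ?muln0 // IH mulnDr. Qed.

Definition block (b : bool) (v : nat) := if b then [:: Gap; step v] else [:: step v; Gap].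
Definition blocks b s := flatten (map (block b) s).

Lemma blocks_cons b v s : blocks b (v :: s) = block b v ++ blocks b s.
Proof. by []. Qed.
Lemma blocks_rcons b s v : blocks b (rcons s v) = blocks b s ++ block b v.
Proof. by rewrite /blocks map_rcons flatten_rcons. Qed.

(** [Up] commutes with all rows. At each gap it passes, the commutator deletes both, which leaves
    the row [v] of that block without its gap. *)
Lemma ev_up_right b p s t :
  ev (p ++ Up :: blocks b s ++ t) =
  ev (p ++ blocks b s ++ Up :: t) +
  split_sum (fun a v c => ev (p ++ blocks b a ++ step v :: blocks b c ++ t)) [::] s.
Proof.
elim: s p => [|v s IH] p; first by rewrite /= addn0.
have -> : ev (p ++ Up :: blocks b (v :: s) ++ t) =
          ev ((p ++ block b v) ++ Up :: blocks b s ++ t) + ev (p ++ step v :: blocks b s ++ t).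
  rewrite blocks_cons; clear IH.
  have := weyl_up_gap p (step v :: blocks b s ++ t) 0 0.
  have := weyl_up_gap (rcons p (step v)) (blocks b s ++ t) 0 0.
  have := weyl_up_down p (Gap :: blocks b s ++ t) 0 0.
  have := weyl_up_down (rcons p Gap) (blocks b s ++ t) 0 0.
  by rewrite /block /step !cat_rcons /ev -!catA; case: b; case: odd => /=; lia.
rewrite IH -!catA [split_sum _ _ (v :: s)]/= split_sum_cons -addnA [_ + ev _]addnC; do 2!congr (_ + _).
by apply: eq_split_sum => a x c _; rewrite /= blocks_cons -!catA.
Qed.

Lemma ev_down_left b p s t :
  ev (p ++ blocks b s ++ Down :: t) =
  ev (p ++ Down :: blocks b s ++ t) +
  split_sum (fun a v c => ev (p ++ blocks b a ++ step v :: blocks b c ++ t)) [::] s.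
Proof.
elim/last_ind: s t => [|s v IH] t; first by rewrite /= addn0.
rewrite split_sum_rcons cat0s.
have -> : ev (p ++ blocks b (rcons s v) ++ Down :: t) =
          ev (p ++ blocks b s ++ Down :: block b v ++ t) + ev (p ++ blocks b s ++ step v :: t).
  rewrite blocks_rcons -catA !(catA p); move: (p ++ blocks b s) => u; clear IH.
  have := weyl_gap_down u (step v :: t) 0 0.
  have := weyl_gap_down (rcons u (step v)) t 0 0.
  have := weyl_up_down u (Gap :: t) 0 0.
  have := weyl_up_down (rcons u Gap) t 0 0.
  by rewrite /block /step !cat_rcons /ev; case: b; case: odd => /=; lia.
rewrite IH blocks_rcons -!catA addnA; congr (_ + _ + _).
by apply: eq_split_sum => a x c _; rewrite blocks_rcons -!catA.
Qed.

(** * Dumont paths, evaluated by removing their first value *)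

Definition dumont_rel (v v' : nat) := (v < v') == ~~ odd v.

(* Paths from x through all of s, sorted by the parity of their last value, on which
   the Dumont condition imposes nothing. *)
Definition path_count (b : bool) (x : nat) (s : seq nat) : nat :=
  count (fun t => path dumont_rel x t && (odd (last x t) == b)) (permutations s).

Lemma path_count_nil b x : path_count b x [::] = (odd x == b).
Proof. by rewrite /path_count /= addn0. Qed.

Lemma path_count_rec b x s : 0 < size s -> uniq s ->
  path_count b x s = \sum_(y <- s | dumont_rel x y) path_count b y (rem y s).
Proof.
move=> s_gt0 us; rewrite /path_count.
have /seq.permP -> := permutationsE s_gt0.
rewrite undup_id // count_flatten sumnE big_map big_map [RHS]big_mkcond /=.
apply: eq_bigr => y _; rewrite count_map /=.
case: ifP => dxy; first by apply: eq_count => t /=; rewrite dxy.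
by rewrite (eq_count (a2 := pred0)) ?count_pred0 // => t /=; rewrite dxy.
Qed.

Lemma sorted_split (w1 w2 : seq nat) x : sorted ltn (w1 ++ x :: w2) ->
  [/\ uniq (w1 ++ w2), {in w1, forall v, v < x} & {in w2, forall v, x < v}].
Proof.
move=> srt; have us := sorted_uniq ltn_trans ltnn srt; move: srt.
rewrite (sorted_pairwise ltn_trans) pairwise_cat /= => /and3P[/allrelP c _ /andP[/allP d _]]; split.
- by move: us; rewrite !cat_uniq /= => /and3P[-> /norP[_ ->] /andP[_ ->]].
- by move=> v vw; apply: c => //; rewrite mem_head.
- by move=> v vw; apply: d.
Qed.

Lemma sorted_without (w1 w2 : seq nat) x : sorted ltn (w1 ++ x :: w2) -> sorted ltn (w1 ++ w2).
Proof.
apply: (subseq_sorted ltn_trans); rewrite cat_subseq //; exact: subseq_cons.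
Qed.

Lemma rem_split (b c : seq nat) v : uniq (b ++ v :: c) -> rem v (b ++ v :: c) = b ++ c.
Proof.
move=> u; rewrite remE.
have vb : v \notin b by move: u; rewrite cat_uniq => /and3P[_ /hasPn /(_ v)]; rewrite mem_head => /(_ isT).
by rewrite index_cat (negPf vb) /= eqxx addn0 take_size_cat // -cat1s catA drop_size_cat // size_cat addn1.
Qed.

(** In a sorted list the admissible successors of [x] are everything below it or everything above
    it. Once [x] is deleted, the successor [v] splits the rest in the same way, so the form is
    stable under recursion. *)
Lemma path_count_split b x w1 w2 : sorted ltn (w1 ++ x :: w2) -> 0 < size (w1 ++ w2) ->
  path_count b x (w1 ++ w2) =
  if odd x then split_sum (fun a v c => path_count b v (a ++ c ++ w2)) [::] w1
  else split_sum (fun a v c => path_count b v (w1 ++ a ++ c)) [::] w2.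
Proof.
move=> srt s_gt0; have [us lt1 lt2] := sorted_split srt.
rewrite path_count_rec // big_cat /=.
case: ifP => ox.
  rewrite [X in _ + X]big1_seq ?addn0; last first.
    by move=> y /andP[+ /lt2]; rewrite /dumont_rel ox /= => /eqP->.
  rewrite -big_filter (_ : [seq _ <- _ | _] = w1); last first.
    by apply/all_filterP/allP => y /lt1; rewrite /dumont_rel ox => yx; rewrite ltnNge (ltnW yx).
  apply: big_split_sum => d v c w1E /=.
  by move: us; rewrite w1E -catA /= => us; rewrite rem_split.
rewrite [X in X + _]big1_seq ?add0n; last first.
  by move=> y /andP[+ /lt1]; rewrite /dumont_rel ox => /= /eqP xy; lia.
rewrite -big_filter (_ : [seq _ <- _ | _] = w2); last first.
  by apply/all_filterP/allP => y /lt2; rewrite /dumont_rel ox /= => ->.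
apply: big_split_sum => d v c w2E /=.
by move: us; rewrite w2E catA => us; rewrite rem_split // -catA.
Qed.

(* The word of w1 ++ x :: w2 with the row of its maximum and the gap before x
   removed, or 0 if that maximum is an Up; first_weight below is its mirror image. *)
Definition last_weight (w1 : seq nat) x (w2 : seq nat) :=
  if rev w2 is z :: w2r then
    odd z * ev (gap_row w1 ++ step x :: gap_row (rev w2r) ++ [:: Gap])
  else odd x * ev (gap_row w1).

Lemma last_weight_rcons w1 x w2 z : last_weight w1 x (rcons w2 z) =
  odd z * ev (gap_row w1 ++ step x :: gap_row w2 ++ [:: Gap]).
Proof. by rewrite /last_weight rev_rcons revK. Qed.

(** Handles an odd maximum visited first: any other value may follow, and the weights of all
    successors must add up to the one word with nothing removed. *)
Lemma last_weight_total w : 0 < size w ->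
  split_sum last_weight [::] w = ev (gap_row w).
Proof.
case/lastP: w => // w z _; rewrite split_sum_rcons /= {2}/last_weight /=.
rewrite (eq_split_sum (g := fun a v c => odd z *
  ev (gap_row a ++ step v :: gap_row c ++ [:: Gap]))); last first.
  by move=> a v c _; rewrite last_weight_rcons.
rewrite split_sum_mul -mulnDr.
have := ev_down_left true [::] w [:: Gap].
rewrite !cat0s ev_down add0n -[blocks true w]/(gap_row w) => <-.
rewrite gap_row_rcons [step z]/step; case: (odd z) => /=; last first.
  by have := weyl_up_end (gap_row w ++ [:: Gap]) 0 0; rewrite -catA /ev.
by have := weyl_gap_down (gap_row w) [::] 0 0; rewrite cats0 /ev; lia.
Qed.

(** The row of [x] is commuted out of the word, and the gap it cancels with is the one before its
    successor [v]; that gap is missing in the word for [v]. An even maximum gives 0: it cannot come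
    last, and it would need a larger successor. *)
Lemma path_count_last x w1 w2 : sorted ltn (w1 ++ x :: w2) ->
  path_count true x (w1 ++ w2) = last_weight w1 x w2.
Proof.
have [n] := ubnP (size (w1 ++ w2)); elim: n => // n IH in x w1 w2 *; rewrite ltnS => le_n srt.
case: (posnP (size (w1 ++ w2))) => [/size0nil|] s_gt0.
  have [-> ->] : w1 = [::] /\ w2 = [::] by move: s_gt0; case: (w1) => //= ->.
  by rewrite path_count_nil /last_weight /= muln1; case: odd.
rewrite path_count_split //.
have IH1 a v c : w1 = a ++ v :: c -> path_count true v (a ++ c ++ w2) = last_weight a v (c ++ w2).
  move=> w1E; move: le_n (sorted_without srt); rewrite w1E -catA /= => le_n srt'.
  by apply: IH => //; move: le_n; rewrite !size_cat /= ?size_cat; lia.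
have IH2 a v c : w2 = a ++ v :: c -> path_count true v (w1 ++ a ++ c) = last_weight (w1 ++ a) v c.
  move=> w2E; move: le_n (sorted_without srt); rewrite w2E catA => le_n srt'.
  by rewrite catA; apply: IH => //; move: le_n; rewrite !size_cat /= ?size_cat; lia.
case: (lastP w2) => [|w2' z] in IH1 IH2 s_gt0 srt *.
  rewrite /last_weight /=; case: ifP => ox //=.
  rewrite mul1n -last_weight_total; last by move: s_gt0; rewrite cats0.
  by apply: eq_split_sum => a v c /IH1; rewrite !cats0.
rewrite last_weight_rcons; case: ifP => ox; rewrite [step x]/step ox.
  rewrite (ev_down_left true [::]) ev_down add0n -split_sum_mul; apply: eq_split_sum => a v c /IH1 -> /=.
  by rewrite -rcons_cat last_weight_rcons gap_row_cat -catA.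
rewrite (ev_up_right true) split_sum_rcons.
(* The last gap belongs to the removed row of the maximum [z]; cancelling [x] with it is the step
   from [x] to [z]. *)
have -> : ev (gap_row w1 ++ blocks true w2' ++ [:: Up; Gap]) = ev (gap_row (w1 ++ w2')).
  have := weyl_up_gap (gap_row (w1 ++ w2')) [::] 0 0.
  have := weyl_up_end (gap_row (w1 ++ w2') ++ [:: Gap]) 0 0.
  by rewrite gap_row_cat cats0 -!catA -[blocks true w2']/(gap_row w2') /ev /=; lia.
rewrite mulnDr addnC; congr (_ + _).
  by rewrite cat0s (IH2 w2' z [::]) ?cats1.
rewrite -split_sum_mul; apply: eq_split_sum => a v c w2'E /=.
rewrite IH2 ?w2'E -?rcons_cons -?rcons_cat // last_weight_rcons gap_row_cat -!catA //.
Qed.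

Definition first_weight (w1 : seq nat) x (w2 : seq nat) :=
  if w1 is z :: w1' then
    ~~ odd z * ev (Gap :: row_gap w1' ++ step x :: row_gap w2)
  else ~~ odd x * ev (row_gap w2).

Lemma first_weight_total w : 0 < size w ->
  split_sum first_weight [::] w = ev (row_gap w).
Proof.
case: w => // z w _; rewrite [LHS]/= split_sum_cons /=.
rewrite split_sum_mul -mulnDr.
have := ev_up_right false [:: Gap] w [::].
rewrite -[blocks false w]/(row_gap w) !cats0.
rewrite (eq_split_sum (g := fun a v c => ev (Gap :: row_gap a ++ step v :: row_gap c))); last first.
  by move=> a v c _; rewrite cats0.
rewrite row_gap_cons [step z]/step; case: (odd z) => //=.
by have := weyl_up_end (Gap :: row_gap w) 0 0; have := weyl_up_gap [::] (row_gap w) 0 0; rewrite /ev /=; lia.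
Qed.

(** The mirror image: the minimum takes the place of the maximum, and gaps stand after their
    rows. *)
Lemma path_count_first x w1 w2 : sorted ltn (w1 ++ x :: w2) ->
  path_count false x (w1 ++ w2) = first_weight w1 x w2.
Proof.
have [n] := ubnP (size (w1 ++ w2)); elim: n => // n IH in x w1 w2 *; rewrite ltnS => le_n srt.
case: (posnP (size (w1 ++ w2))) => [/size0nil|] s_gt0.
  have [-> ->] : w1 = [::] /\ w2 = [::] by move: s_gt0; case: (w1) => //= ->.
  by rewrite path_count_nil /first_weight /= muln1; case: odd.
rewrite path_count_split //.
have IH1 a v c : w1 = a ++ v :: c -> path_count false v (a ++ c ++ w2) = first_weight a v (c ++ w2).
  move=> w1E; move: le_n (sorted_without srt); rewrite w1E -catA /= => le_n srt'.
  by apply: IH => //; move: le_n; rewrite !size_cat /= ?size_cat; lia.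
have IH2 a v c : w2 = a ++ v :: c -> path_count false v (w1 ++ a ++ c) = first_weight (w1 ++ a) v c.
  move=> w2E; move: le_n (sorted_without srt); rewrite w2E catA => le_n srt'.
  by rewrite catA; apply: IH => //; move: le_n; rewrite !size_cat /= ?size_cat; lia.
case: w1 => [|z w1] in IH1 IH2 s_gt0 srt le_n *.
  rewrite /first_weight /=; case: ifP => ox //=.
  rewrite mul1n -first_weight_total //.
  by apply: eq_split_sum => a v c /IH2.
rewrite /first_weight; case: ifP => ox; rewrite [step x]/step ox; last first.
  have := ev_up_right false (Gap :: row_gap w1) w2 [::].
  rewrite !cats0 /= => ->.
  have -> : ev (Gap :: row_gap w1 ++ blocks false w2 ++ [:: Up]) = 0.
    by have := weyl_up_end (Gap :: row_gap w1 ++ row_gap w2) 0 0; rewrite /= -!catA.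
  rewrite add0n -split_sum_mul; apply: eq_split_sum => a v c /IH2 -> /=.
  by rewrite cats0 row_gap_cat -catA.
have -> : ev (Gap :: row_gap w1 ++ Down :: row_gap w2) =
   ev (row_gap w1 ++ row_gap w2) + split_sum (fun a v c => ev (Gap :: row_gap a ++ step v :: row_gap c ++ row_gap w2)) [::] w1.
  rewrite (ev_down_left false [:: Gap] w1 (row_gap w2)); congr (_ + _).
  by rewrite -[row_gap w1]/(blocks false w1) /ev /=; lia.
rewrite [LHS]/= split_sum_cons mulnDr; congr (_ + _).
  by rewrite (IH1 [::]) //= row_gap_cat.
rewrite -split_sum_mul; apply: eq_split_sum => a v c w1E /=.
by rewrite (IH1 (z :: a)) ?w1E //= row_gap_cat.
Qed.

(** * From paths to Dumont permutations, and the recurrence for their numbers *)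

Lemma permutation_image n (s : 'S_n) :
  perm_eq [seq val (s i) | i <- enum 'I_n] (iota 0 n).
Proof.
apply: uniq_perm; first 1 last.
- exact: iota_uniq.
- move=> v; rewrite mem_iota add0n leq0n; apply/mapP/idP => [[i _ ->]|vn]; first exact: ltn_ord.
  by exists ((s^-1)%g (Ordinal vn)); rewrite ?mem_enum // permKV.
by rewrite map_inj_uniq ?enum_uniq // => i j /val_inj/perm_inj.
Qed.

Lemma card_perm_count n (Q : pred (seq nat)) :
  #|[pred s : 'S_n | Q [seq val (s i) | i <- enum 'I_n]]| = count Q (permutations (iota 0 n)).
Proof.
pose h (s : 'S_n) := [seq val (s i) | i <- enum 'I_n].
have h_inj : injective h.
  move=> s t /eq_in_map st; apply/permP => i; apply: val_inj; apply: st; exact: mem_enum.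
rewrite cardE -(size_map h) -size_filter; apply/perm_size/uniq_perm.
- by rewrite map_inj_uniq ?enum_uniq.
- by rewrite filter_uniq ?permutations_uniq.
move=> t; rewrite mem_filter mem_permutations; apply/mapP/andP => [[s]|[Qt tE]].
  by rewrite mem_enum inE => Qs ->; split => //; apply: permutation_image.
have szt : size t = n by rewrite (perm_size tE) size_iota.
have ltt i : i < n -> nth 0 t i < n.
  by move=> i_n; have := perm_mem tE (nth 0 t i); rewrite mem_nth ?szt // mem_iota add0n => /esym.
pose f (i : 'I_n) := Ordinal (ltt i (ltn_ord i)).
have f_inj : injective f.
  move=> i j [] /eqP; rewrite nth_uniq ?szt ?ltn_ord //; first by move=> /eqP/val_inj.
  by rewrite (perm_uniq tE) iota_uniq.
have hE : h (perm f_inj) = t.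
  apply: (@eq_from_nth _ 0); first by rewrite size_map size_enum_ord szt.
  move=> i; rewrite size_map size_enum_ord => i_n.
  rewrite (nth_map (Ordinal i_n)) ?size_enum_ord // permE /=; congr nth; exact: nth_enum_ord.
by exists (perm f_inj); rewrite ?mem_enum ?inE ?hE // -/(h _) hE.
Qed.

Lemma dumont_sorted n (s : 'S_n) :
  dumont s = sorted dumont_rel [seq val (s i) | i <- enum 'I_n].
Proof.
set t := map _ _; have szt : size t = n by rewrite size_map size_enum_ord.
have nthE (i : 'I_n) : nth 0 t i = s i.
  by rewrite (nth_map i) ?size_enum_ord // nth_ord_enum.
apply/forallP/(sortedP 0) => [ds i|st i].
  rewrite szt => i_n.
  have := ds (Ordinal (ltnW i_n)) => /forallP/(_ (Ordinal i_n)) /=.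
  rewrite eqxx /= => /eqP sE; rewrite /dumont_rel.
  by rewrite (nthE (Ordinal (ltnW i_n))) (nthE (Ordinal i_n)) sE.
apply/forallP => i'; apply/implyP => /eqP i'E.
have := st i; rewrite szt -i'E ltn_ord !nthE => /(_ isT).
by rewrite /dumont_rel.
Qed.

Lemma rem_iota n x : x < n -> rem x (iota 0 n) = iota 0 x ++ iota x.+1 (n - x.+1).
Proof.
move=> xn; have iE : iota 0 n = iota 0 x ++ x :: iota x.+1 (n - x.+1).
  by rewrite -[x :: _]/(iota x (n - x.+1).+1) subnSK // -iotaD subnKC // ltnW.
by rewrite iE rem_split // -iE iota_uniq.
Qed.

Lemma dumont_count_path n x : x < n ->
  dumont_count n.+1 x.+1 =
  path_count true x (iota 0 x ++ iota x.+1 (n - x.+1)) +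
  path_count false x (iota 0 x ++ iota x.+1 (n - x.+1)).
Proof.
move=> xn; have n_gt0 : 0 < n by apply: leq_ltn_trans xn.
pose Q t := sorted dumont_rel t && (head n t == x).
have -> : dumont_count n.+1 x.+1 = #|[pred s : 'S_n | Q [seq val (s i) | i <- enum 'I_n]]|.
  apply: eq_card => s; rewrite !inE dumont_sorted /Q; congr (_ && _).
  have -> : head n [seq val (s i) | i <- enum 'I_n] = s (Ordinal n_gt0).
    rewrite -nth0 (nth_map (Ordinal n_gt0)) ?size_enum_ord //; congr (val (s _)).
    by apply: val_inj; rewrite /= nth_enum_ord.
  apply/existsP/idP => [[i /andP[/eqP i0]]|sx].
    by rewrite eqSS; congr (val (s _) == _); apply: val_inj.
  by exists (Ordinal n_gt0); rewrite eqxx eqSS.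
rewrite card_perm_count.
have /seq.permP -> := @permutationsE _ (iota 0 n) ltac:(by rewrite size_iota).
rewrite undup_id ?iota_uniq // count_flatten sumnE big_map big_map.
rewrite (bigD1_seq x) ?iota_uniq ?mem_iota //= big1 ?addn0; last first.
  move=> y yx; rewrite count_map (eq_count (a2 := pred0)) ?count_pred0 // => t.
  by rewrite /Q /= (negPf yx) andbF.
rewrite rem_iota // count_map /path_count -count_predUI.
rewrite [X in _ + X](eq_count (a2 := pred0)) ?count_pred0 ?addn0; last first.
  by move=> t /=; case: path => //=; case: odd.
apply: eq_count => t /=; rewrite /Q /= eqxx andbT.
by case: path => //=; case: odd.
Qed.

Lemma sorted_iota_split n x : x < n -> sorted ltn (iota 0 x ++ x :: iota x.+1 (n - x.+1)).
Proof.
move=> xn; have -> : iota 0 x ++ x :: iota x.+1 (n - x.+1) = iota 0 n; last exact: iota_ltn_sorted.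
by rewrite -[x :: _]/(iota x (n - x.+1).+1) subnSK // -iotaD subnKC // ltnW.
Qed.

(** The two terms come from an odd and an even last value, counted from 0. With [L] even the maximum
    [L.+1] is a [Down]; once its row is removed, the last row is an [Up] before the final gap, and
    the two cancel. At the other end, removing the row of 0 lets the first gap cancel with the
    [Down] of 1. *)
Lemma dumont_countE L x : ~~ odd L -> x <= L.+1 ->
  dumont_count L.+3 x.+1 = qcount L x + (if x is y.+1 then qcount L y else 0).
Proof.
move=> Leven xL; rewrite dumont_count_path ?ltnS //.
rewrite path_count_last ?path_count_first ?sorted_iota_split ?ltnS //.
congr (_ + _).
  have stepL : step L = Up by rewrite /step (negPf Leven).
  move: xL; rewrite leq_eqVlt => /orP[/eqP ->|xL].
    rewrite subnn /last_weight /= Leven mul1n gap_row_iotaS stepL.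
    rewrite /qcount ltnn.
    by have := weyl_up_end (gap_row (iota 0 L) ++ [:: Gap]) 0 0; rewrite -catA.
  have -> : iota x.+1 (L.+2 - x.+1) = rcons (iota x.+1 (L - x)) L.+1.
    have -> : L.+2 - x.+1 = (L - x).+1 by lia.
    by rewrite -[(L - x).+1]addn1 iotaD cats1; congr (rcons _ _); lia.
  rewrite last_weight_rcons /= Leven mul1n.
  rewrite gap_row_gap -row_gap_cons.
  have -> : x :: iota x.+1 (L - x) = rcons (iota x (L - x)) L.
    by rewrite -[LHS]/(iota x (L - x).+1) -[(L - x).+1]addn1 iotaD cats1; congr (rcons _ _); lia.
  rewrite qcountE // -cats1 row_gap_cat /= /row_gap /= -/(row_gap _) stepL.
  have := weyl_up_gap (gap_row (iota 0 x) ++ row_gap (iota x (L - x))) [::] 0 0.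
  have := weyl_up_end (gap_row (iota 0 x) ++ row_gap (iota x (L - x)) ++ [:: Gap]) 0 0.
  by rewrite -!catA !cats0 /ev /= => ->.
case: x xL => [|x] xL; first by rewrite /first_weight /= row_gap_cons.
rewrite /first_weight /= mul1n.
have -> : ev (Gap :: row_gap (iota 1 x) ++ step x.+1 :: row_gap (iota x.+2 (L.+2 - x.+2))) =
   ev (gap_row (iota 1 x.+1) ++ row_gap (iota x.+2 (L - x))).
  rewrite -cat_cons -gap_row_gap -[x.+1 in RHS]addn1 iotaD gap_row_cat add1n -!catA /= !subSS.
  by rewrite addn1.
rewrite qcountE // row_gap_shift [iota 1 x.+1]/= gap_row_cons gap_row_shift /step /=.
by rewrite /ev /=; lia.
Qed.

Lemma qcount_gt L i : L < i -> qcount L i = 0.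
Proof. by rewrite /qcount ltnNge => /negPf ->. Qed.

Lemma dumont_count0 n : dumont_count n 0 = 0.
Proof. by apply: eq_card0 => s; rewrite !inE; apply/negbTE; rewrite negb_and; apply/orP; right; apply/existsP => -[i]; rewrite andbF. Qed.

Lemma dumont_count_max n : dumont_count n n = 0.
Proof.
apply: eq_card0 => s; rewrite !inE; apply/negbTE; rewrite negb_and; apply/orP; right.
apply/existsP => -[i /andP[_ /eqP]]; have := ltn_ord (s i); lia.
Qed.

Lemma dumont_count_three : dumont_count 3 1 = 1 /\ dumont_count 3 2 = 1.
Proof. by rewrite !dumont_countE. Qed.

Lemma dumont_count_rec n m : odd n -> m <= n ->
  3 <= n ->
  dumont_count n.+2 m.+2 + dumont_count n.+2 m + dumont_count n m
  = 2 * dumont_count n.+2 m.+1.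
Proof.
case: n => [|[|[|L]]] // nodd mL _.
have Leven : ~~ odd L by move: nodd => /=; rewrite negbK.
have L2even : ~~ odd L.+2 by rewrite /= negbK.
case: m => [|[|i]] in mL *.
- by rewrite !dumont_count0 !dumont_countE // qcount_start; lia.
- by rewrite !dumont_countE //; have := qcount_second L; lia.
case: (ltngtP i L) => iL.
- by rewrite !dumont_countE ?(ltnW iL) //; first (have := @qcount_rec L i iL; lia); lia.
- have -> : i = L.+1 by lia.
  rewrite !dumont_count_max !dumont_countE // (@qcount_gt L.+2 L.+3) //.
  by have := qcount_last Leven; lia.
- rewrite iL !dumont_countE //; last by lia.
  rewrite (@qcount_gt L.+2 L.+3) // (@qcount_gt L L.+1) //.
  by have := qcount_penultimate Leven; lia.
Qed.

Local Open Scope classical_set_scope.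
Local Open Scope ring_scope.

(** * Truncated power series *)

Section DerivativeRules.
Variable R : realType.
Implicit Types (f g h : R -> R) (a b x : R).

Lemma der_cst x a : is_derive x 1 (fun=> a : R) 0.
Proof. exact: is_derive_cst. Qed.

Lemma derD f g x a b : is_derive x 1 f a -> is_derive x 1 g b ->
  is_derive x 1 (fun z => f z + g z) (a + b).
Proof. exact: is_deriveD. Qed.

Lemma derB f g x a b : is_derive x 1 f a -> is_derive x 1 g b ->
  is_derive x 1 (fun z => f z - g z) (a - b).
Proof. exact: is_deriveB. Qed.

Lemma derM f g x a b : is_derive x 1 f a -> is_derive x 1 g b ->
  is_derive x 1 (fun z => f z * g z) (f x * b + g x * a).
Proof. exact: is_deriveM. Qed.

Lemma derMl f x a b : is_derive x 1 f a -> is_derive x 1 (fun z => b * f z) (b * a).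
Proof. exact: is_deriveZ. Qed.

Lemma derX f n x a : is_derive x 1 f a ->
  is_derive x 1 (fun z => f z ^+ n) (n%:R * f x ^+ n.-1 * a).
Proof. by move=> fa; rewrite -exprfctE; exact: is_deriveX. Qed.

Lemma der_comp f g x a b : is_derive (g x) 1 f a -> is_derive x 1 g b ->
  is_derive x 1 (fun z => f (g z)) (a * b).
Proof. exact: is_derive1_comp. Qed.

Lemma der_sum (I : Type) (r : seq I) (F : I -> R -> R) (dF : I -> R) x :
  (forall i, is_derive x 1 (F i) (dF i)) ->
  is_derive x 1 (fun z => \sum_(i <- r) F i z) (\sum_(i <- r) dF i).
Proof.
move=> FdF; elim: r => [|i r IH].
  by rewrite big_nil; under eq_fun do rewrite big_nil; apply: der_cst.
by rewrite big_cons; under eq_fun do rewrite big_cons; apply: derD.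
Qed.

Lemma der_id x : is_derive x 1 (fun z : R => z) 1.
Proof. exact: is_derive_id. Qed.

Lemma der_eq f x a b : is_derive x 1 f a -> a = b -> is_derive x 1 f b.
Proof. by move=> fa <-. Qed.

Lemma mean_value_bound f (f' : R -> R) a b C :
  a <= b -> (forall z : R, a <= z <= b -> is_derive z 1 f (f' z)) ->
  (forall z, a < z < b -> `|f' z| <= C) -> `|f b - f a| <= C * (b - a).
Proof.
rewrite le_eqVlt => /predU1P[-> _ _|ab fd fC]; first by rewrite !subrr normr0 mulr0.
have [||c] := @MVT R f f' a b ab.
- by move=> z; rewrite in_itv /= => /andP[az zb]; apply: fd; rewrite !ltW.
- apply: derivable_within_continuous => z; rewrite in_itv /= => zab.
  by case: (fd z zab).
rewrite in_itv /= => cab ->; have ba : 0 <= b - a by rewrite subr_ge0 ltW.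
by rewrite normrM (ger0_norm ba); apply: ler_wpM2r; rewrite ?fC.
Qed.

(** Replaces the integration of an inequality: [h - f] and [h + f] have nonnegative derivatives. *)
Lemma derivative_dominated f (f' : R -> R) h (h' : R -> R) :
  (forall z : R, is_derive z 1 f (f' z)) -> (forall z : R, is_derive z 1 h (h' z)) ->
  f 0 = 0 -> h 0 = 0 -> (forall z, 0 < z < 1 -> `|f' z| <= h' z) ->
  forall z, 0 <= z <= 1 -> `|f z| <= h z.
Proof.
move=> fd hd f0 h0 fh z /andP[]; rewrite le_eqVlt => /predU1P[<- _|z0 z1].
  by rewrite f0 h0 normr0.
have mvt (g g' : R -> R) : (forall z : R, is_derive z 1 g (g' z)) -> g 0 = 0 ->
    (forall z, 0 < z < 1 -> 0 <= g' z) -> 0 <= g z.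
  move=> gd g0 g'0; have [|c] := @MVT R g g' 0 z z0 (fun x _ => gd x).
    by apply: derivable_within_continuous => x _; case: (gd x).
  rewrite in_itv /= g0 !subr0 => /andP[c0 cz] ->.
  by rewrite mulr_ge0 ?(ltW z0) // g'0 // c0 (lt_le_trans cz).
rewrite ler_norml; apply/andP; split.
  rewrite -subr_ge0 opprK; apply: (mvt _ _ (fun x => derD (fd x) (hd x))).
    by rewrite f0 h0 addr0.
  by move=> x /fh; rewrite ler_norml => /andP[+ _]; rewrite -subr_ge0 opprK.
rewrite -subr_ge0; apply: (mvt _ _ (fun x => derB (hd x) (fd x))).
  by rewrite f0 h0 subr0.
by move=> x /fh; rewrite ler_norml => /andP[_]; rewrite subr_ge0.
Qed.

End DerivativeRules.

Section Coefficients.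
Variable R : realType.

(* alt u m = u (m-1) - u (m-3) + u (m-5) - ... *)
Fixpoint alt (u : nat -> R) (m : nat) : R :=
  if m is m1.+1 then u m1 - (if m1 is m2.+1 then alt u m2 else 0) else 0.

Lemma altS u m : alt u m.+1 = u m - alt u m.-1.
Proof. by case: m. Qed.

Lemma alt0 u : alt u 0 = 0.
Proof. by []. Qed.

(* Coefficient of z^m in the generating series of tilde T at z = tan(theta/2), signs
   included. Here and below an index is listed from its last entry to its first. *)
Fixpoint tcoef (k : seq nat) (m : nat) : R :=
  if k is s :: k' then 2 * alt (tcoef k') m / m%:R ^+ s else (m == 0%N)%:R.

Lemma tcoef_cons s k m : tcoef (s :: k) m = 2 * alt (tcoef k) m / m%:R ^+ s.
Proof. by []. Qed.

Lemma tcoef_cons0 s k : tcoef (s :: k) 0 = 0.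
Proof. by rewrite tcoef_cons mulr0 mul0r. Qed.

Arguments alt : simpl never.
Arguments tcoef : simpl never.

Definition psum (k : seq nat) (M : nat) (z : R) : R :=
  \sum_(m < M.+1) tcoef k m * z ^+ m.

Definition dpsum (k : seq nat) (M : nat) (z : R) : R :=
  \sum_(m < M.+1) tcoef k m * (m%:R * z ^+ m.-1).

Lemma der_psum k M (z : R) : is_derive z 1 (psum k M) (dpsum k M z).
Proof.
apply: der_sum => m; apply: derMl; apply: der_eq.
  by apply: derX; apply: der_id.
by rewrite mulr1.
Qed.

Lemma psumS k M z : psum k M.+1 z = psum k M z + tcoef k M.+1 * z ^+ M.+1.
Proof. exact: big_ord_recr. Qed.

Lemma dpsumS k M z : dpsum k M.+1 z = dpsum k M z + tcoef k M.+1 * (M.+1%:R * z ^+ M).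
Proof. exact: big_ord_recr. Qed.

Lemma psum_nil M z : psum [::] M z = 1.
Proof. by rewrite /psum big_ord_recl /= mul1r expr0 big1 ?addr0 // => i _; rewrite /= mul0r. Qed.

Lemma psum0 s k M : psum (s :: k) M 0 = 0.
Proof.
rewrite /psum big_ord_recl /= big1 ?addr0; first by rewrite tcoef_cons0 mul0r.
by move=> i _; rewrite /= expr0n mulr0.
Qed.

(** Prepending an entry 1 multiplies by 2/(1 + z^2) and integrates; the two terms in [alt] are the
    boundary terms of the cutoff. *)
Lemma dpsum_one k M z : (1 + z ^+ 2) * dpsum (1%N :: k) M z =
  2 * psum k M z - 2 * alt (tcoef k) M.+1 * z ^+ M + 2 * alt (tcoef k) M * z ^+ M.+1.
Proof.
elim: M => [|M IH].
  by rewrite /dpsum /psum !big_ord1 altS /= alt0 tcoef_cons0; ring.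
rewrite dpsumS psumS mulrDr IH (altS _ M.+1).
rewrite tcoef_cons expr1 [M.+1.-1]/= (exprS z M.+1) (exprS z M).
have M0 : M.+1%:R != 0 :> R by rewrite pnatr_eq0.
move: (tcoef k M.+1) (alt (tcoef k) M.+1) (alt (tcoef k) M) (z ^+ M) (psum k M z) M0 => p q r t v.
by move: (M.+1%:R : R) => w w0; field.
Qed.

Lemma dpsum_succ s k M z : z * dpsum (s.+2 :: k) M z = psum (s.+1 :: k) M z.
Proof.
rewrite /dpsum /psum mulr_sumr; apply: eq_bigr => -[m _] _ /=.
case: m => [|m]; first by rewrite !tcoef_cons0 !mul0r mulr0.
have M0 : m.+1%:R != 0 :> R by rewrite pnatr_eq0.
rewrite !tcoef_cons !exprS /=; field.
by rewrite expf_neq0 //= -natrD add1n.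
Qed.

Lemma alt_le u m : `|alt u m| <= \sum_(y < m) `|u y|.
Proof.
have [n] := ubnP m; elim: n m => // n IH [|m]; first by rewrite big_ord0 normr0.
rewrite ltnS altS big_ord_recr /= addrC => mn.
apply: (le_trans (ler_normB _ _)); rewrite lerD2l.
case: m mn => [|m] mn; first by rewrite normr0 big_ord0.
apply: le_trans (IH _ _) _; first by rewrite /=; lia.
by rewrite /= big_ord_recr /= lerDl.
Qed.

Definition positive_index (k : seq nat) := all (leq 1) k.

Lemma mean_tcoef_null k : tcoef k m @[m --> \oo] --> (0 : R) ->
  forall e, 0 < e -> exists N, forall M, (N <= M)%N ->
  \sum_(y < M.+1) `|tcoef k y| <= e * M.+1%:R.
Proof.
move=> ck e e0.
have : arithmetic_mean (fun m => `|tcoef k m|) @ \oo --> (0 : R).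
  by apply: cesaro; rewrite -(normr0 R); apply: cvg_norm.
move=> /cvgrPdist_le /(_ e e0)[N _ H].
exists N => M NM; have := H M NM; rewrite /= sub0r normrN /arithmetic_mean /series /=.
rewrite big_mkord mulrC ger0_norm; last by rewrite mulr_ge0 ?sumr_ge0.
by rewrite ler_pdivrMr ?ltr0n.
Qed.

(** An entry [s = 1] divides by [m] only once. That suffices: the alternating sum of null
    coefficients is o(m), by Cesaro means of absolute values. *)
Lemma tcoef_null k : positive_index k -> tcoef k m @[m --> \oo] --> (0 : R).
Proof.
elim: k => [_|s k IH /andP[s1 /IH ck]].
  apply/cvgrPdist_le => e e0; exists 1%N => // -[//|m] _ /=.
  by rewrite subr0 normr0 ltW.
apply/cvgrPdist_le => e e0; have e2 : 0 < e / 2 by rewrite divr_gt0.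
have [N H] := mean_tcoef_null ck e2.
exists N.+1 => // -[//|m] /=; rewrite ltnS => Nm; rewrite sub0r normrN.
case: s s1 => // s _; rewrite tcoef_cons exprS.
have alt_e : `|alt (tcoef k) m.+1| <= e / 2 * m.+1%:R by apply: le_trans (alt_le _ _) (H _ Nm).
have w0 : 0 < m.+1%:R :> R by rewrite ltr0n.
have ws : 1 <= m.+1%:R ^+ s :> R by rewrite exprn_ege1 // ler1n.
have ws0 : 0 < m.+1%:R ^+ s :> R by apply: lt_le_trans ws.
rewrite normrM normfV normrM ger0_norm // [X in _ / X]ger0_norm; last by rewrite mulr_ge0 ?ltW.
rewrite ler_pdivrMr; last by rewrite mulr_gt0.
apply: (@le_trans _ _ (e * m.+1%:R)); first by lra.
by rewrite mulrA ler_peMr // mulr_ge0 ?ltW.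
Qed.

End Coefficients.
Arguments alt : simpl never.
Arguments tcoef : simpl never.

(** * Error estimates that are uniform up to z = 1 *)

Section Small.
Variable R : realType.
Implicit Types (f g h : nat -> nat -> R -> R) (e z B : R).

Definition weight (M K : nat) (z : R) : R := 1 + M.+1%:R * z ^+ M + K.+1%:R * z ^+ K.

(* The cutoffs M and K tend to infinity independently. The factor z survives a
   division by z, which is what dz/z requires. *)
Definition small f := forall e, 0 < e -> exists N, forall M K, (N <= M)%N -> (N <= K)%N ->
  forall z, 0 <= z <= 1 -> `|f M K z| <= e * z.

(* Functions whose primitives are small: the weight is the derivative of
   z + z^(M+1) + z^(K+1). It dominates the truncation error perr, which is
   small only after integration. *)
Definition dsmall f := forall e, 0 < e -> exists N, forall M K, (N <= M)%N -> (N <= K)%N ->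
  forall z, 0 < z < 1 -> `|f M K z| <= e * weight M K z.

Lemma weight_ge1 M K z : 0 < z -> 1 <= weight M K z.
Proof.
by move=> z0; rewrite /weight -addrA lerDl addr_ge0 // mulr_ge0 // exprn_ge0 // ltW.
Qed.

Lemma eq_dsmall f g : (forall M K z, 0 < z < 1 -> f M K z = g M K z) -> dsmall f -> dsmall g.
Proof.
move=> fg fs e e0; have [N H] := fs e e0; exists N => M K NM NK z z01.
by rewrite -fg // H.
Qed.

Lemma dsmall0 : dsmall (fun _ _ _ => 0).
Proof.
move=> e e0; exists 0%N => M K _ _ z /andP[z0 _]; rewrite normr0.
by rewrite mulr_ge0 ?(ltW e0) // (le_trans _ (weight_ge1 M K z0)).
Qed.

Lemma dsmallD f g : dsmall f -> dsmall g -> dsmall (fun M K z => f M K z + g M K z).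
Proof.
move=> fs gs e e0; have e2 : 0 < e / 2 by rewrite divr_gt0.
have [N H] := fs _ e2; have [N' H'] := gs _ e2.
exists (maxn N N') => M K; rewrite !geq_max => /andP[NM NM'] /andP[NK NK'] z z01.
apply: le_trans (ler_normD _ _) _.
by have := H M K NM NK z z01; have := H' M K NM' NK' z z01; lra.
Qed.

Lemma dsmallM B h f : (forall M K z, 0 < z < 1 -> `|h M K z| <= B) -> dsmall f ->
  dsmall (fun M K z => h M K z * f M K z).
Proof.
move=> hB fs e e0.
have B0 : 0 < `|B| + 1 by rewrite ltr_wpDl.
have [N H] := fs (e / (`|B| + 1)) ltac:(by rewrite divr_gt0).
exists N => M K NM NK z z01; rewrite normrM.
have -> : e * weight M K z = (`|B| + 1) * (e / (`|B| + 1) * weight M K z).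
  by field; rewrite gt_eqF.
apply: ler_pM => //; last exact: H.
by apply: le_trans (hB M K z z01) _; rewrite (le_trans (ler_norm B)) // lerDl.
Qed.

Lemma dsmallN f : dsmall f -> dsmall (fun M K z => - f M K z).
Proof.
move=> fs e e0; have [N H] := fs e e0; exists N => M K NM NK z z01.
by rewrite normrN H.
Qed.

Lemma dsmall_sum (I : Type) (r : seq I) (F : I -> nat -> nat -> R -> R) :
  (forall i, dsmall (F i)) -> dsmall (fun M K z => \sum_(i <- r) F i M K z).
Proof.
move=> Fs; elim: r => [|i r IH].
  by apply: eq_dsmall dsmall0 => *; rewrite big_nil.
by apply: eq_dsmall (dsmallD (Fs i) IH) => *; rewrite big_cons.
Qed.

Lemma small_dsmall f : small f -> dsmall (fun M K z => f M K z / z).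
Proof.
move=> fs e e0; have [N H] := fs e e0; exists N => M K NM NK z /andP[z0 z1].
have z01 : 0 <= z <= 1 by rewrite !ltW.
have fe := H M K NM NK z z01.
rewrite normrM normfV (gtr0_norm z0) ler_pdivrMr //.
apply: le_trans fe _; rewrite -mulrA ler_pM2l // ler_peMl ?(ltW z0) //.
exact: weight_ge1.
Qed.

Lemma small_dsmall_id f : small f -> dsmall f.
Proof.
move=> /small_dsmall fs; apply: (@eq_dsmall (fun M K z => z * (f M K z / z))).
  by move=> M K z /andP[z0 _]; rewrite mulrCA divff ?mulr1 // gt_eqF.
by apply: (dsmallM (B := 1)) fs => M K z /andP[z0 z1]; rewrite ger0_norm ltW.
Qed.

Lemma eq_small f g : (forall M K z, f M K z = g M K z) -> small f -> small g.
Proof.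
move=> fg fs e e0; have [N H] := fs e e0; exists N => M K NM NK z z01.
by rewrite -fg H.
Qed.

Lemma small0 : small (fun _ _ _ => 0).
Proof.
move=> e e0; exists 0%N => M K _ _ z /andP[z0 _]; rewrite normr0.
by rewrite mulr_ge0 ?(ltW e0).
Qed.

Lemma small_primitive f f' : (forall M K, f M K 0 = 0) ->
  (forall M K z, is_derive z 1 (f M K) (f' M K z)) -> dsmall f' -> small f.
Proof.
(* A third, since the primitive [z + z ^+ M.+1 + z ^+ K.+1] of the weight is at most [3 * z]. *)
move=> f0 fd fs e e0; have e3 : 0 < e / 3 by rewrite divr_gt0.
have [N H] := fs _ e3; exists N => M K NM NK z z01.
have := @derivative_dominated R (f M K) (f' M K)
  (fun z => e / 3 * (z + z ^+ M.+1 + z ^+ K.+1)) (fun z => e / 3 * weight M K z).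
move=> /(_ (fd M K)) h; apply: le_trans (h _ (f0 M K) _ (H M K NM NK) z z01) _.
- move=> x; apply: (@derMl R (fun z => z + z ^+ M.+1 + z ^+ K.+1)); rewrite /weight.
  have dX n : is_derive x 1 (fun y : R => y ^+ n.+1) (n.+1%:R * x ^+ n).
    by apply: der_eq (derX n.+1 (der_id x)) _; rewrite mulr1.
  exact: derD (derD (der_id x) (dX M)) (dX K).
- by rewrite !expr0n !addr0 mulr0.
case/andP: z01 => z0 z1.
have zX n : z ^+ n.+1 <= z by rewrite exprS ler_piMr // exprn_ile1.
have := zX M; have := zX K.
set a := z ^+ _; set b := z ^+ _ => bz az.
have -> : e * z = e / 3 * (z + z + z) by field.
by rewrite ler_pM2l // !lerD.
Qed.

End Small.

(** * Truncation errors of the generating series *)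

Section Indices.
Variable R : realType.
Local Notation psum := (@psum R).
Local Notation dpsum := (@dpsum R).

Definition perr (k : seq nat) (M : nat) (z : R) : R :=
  (2 * alt (tcoef R k) M * z ^+ M.+1 - 2 * alt (tcoef R k) M.+1 * z ^+ M) / (1 + z ^+ 2).

Lemma oneDsqr_neq0 (z : R) : 1 + z ^+ 2 != 0.
Proof. by rewrite gt_eqF // ltr_pwDl // sqr_ge0. Qed.

Lemma dpsum_oneE k M (z : R) :
  dpsum (1%N :: k) M z = 2 / (1 + z ^+ 2) * psum k M z + perr k M z.
Proof.
have n0 := oneDsqr_neq0 z; apply: (mulfI n0); rewrite dpsum_one /perr.
by field.
Qed.

Lemma perr_bound k : positive_index k -> forall e : R, 0 < e -> exists N, forall M, (N <= M)%N ->
  forall z : R, 0 < z < 1 -> `|perr k M z| <= e * (M.+1%:R * z ^+ M).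
Proof.
(* The quarter pays for the two terms of [perr], each with a factor 2. *)
move=> k1 e e0; have e4 : 0 < e / 4 by rewrite divr_gt0.
have [N H] := mean_tcoef_null (@tcoef_null R k k1) e4.
exists N => M NM z /andP[z0 z1]; have := H M NM.
set s := \sum_(y < _) _ => sM.
have altS1 : `|alt (tcoef R k) M.+1| <= s by apply: alt_le.
have alt1 : `|alt (tcoef R k) M| <= s.
  by apply: le_trans (alt_le _ _) _; rewrite /s big_ord_recr lerDl.
have z2 : 1 <= 1 + z ^+ 2 by rewrite lerDl sqr_ge0.
have zM0 : 0 <= z ^+ M by rewrite exprn_ge0 // ltW.
rewrite /perr normrM normfV (ger0_norm (le_trans ler01 z2)).
rewrite ler_pdivrMr ?(lt_le_trans ltr01 z2) //.
apply: (@le_trans _ _ (e * (M.+1%:R * z ^+ M))); last first.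
  by rewrite ler_peMr // mulr_ge0 ?(ltW e0) // mulr_ge0.
apply: le_trans (ler_normB _ _) _; rewrite !normrM !(ger0_norm (ler0n _ 2)).
rewrite (ger0_norm zM0) (ger0_norm (exprn_ge0 M.+1 (ltW z0))) exprS.
apply: (@le_trans _ _ (4 * s * z ^+ M)); last first.
  by rewrite mulrA ler_wpM2r // mulrC -ler_pdivlMr // mulrAC.
have zz : z * z ^+ M <= z ^+ M by rewrite ler_piMl // ltW.
have h1 : 2 * `|alt (tcoef R k) M| * (z * z ^+ M) <= 2 * s * z ^+ M.
  by apply: ler_pM => //; rewrite ?mulr_ge0 ?(ltW z0) // ler_pM2l.
have h2 : 2 * `|alt (tcoef R k) M.+1| * z ^+ M <= 2 * s * z ^+ M.
  by rewrite ler_wpM2r // ler_pM2l.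
by lra.
Qed.

Lemma perr_dsmall k : positive_index k -> dsmall (fun M K z => perr k M z).
Proof.
move=> k1 e e0; have [N H] := perr_bound k1 e0; exists N => M K NM NK z z01.
apply: le_trans (H M NM z z01) _; rewrite ler_pM2l // /weight addrAC lerDr.
by case/andP: z01 => z0 _; rewrite addr_ge0 // mulr_ge0 // exprn_ge0 // ltW.
Qed.

Lemma perr_dsmall_r k : positive_index k -> dsmall (fun M K z => perr k K z).
Proof.
move=> k1 e e0; have [N H] := perr_bound k1 e0; exists N => M K NM NK z z01.
apply: le_trans (H K NK z z01) _; rewrite ler_pM2l // /weight lerDr.
by case/andP: z01 => z0 _; rewrite addr_ge0 // mulr_ge0 // exprn_ge0 // ltW.
Qed.

Lemma factor_bound (z : R) : `|2 / (1 + z ^+ 2)| <= 2.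
Proof.
have z2 : 1 <= 1 + z ^+ 2 by rewrite lerDl sqr_ge0.
rewrite ger0_norm ?divr_ge0 // ?(le_trans ler01 z2) //.
by rewrite ler_pdivrMr ?(lt_le_trans ltr01 z2) // ler_peMr.
Qed.

(** [M] and [K] cut off the same series here. At [z = 1] this gives the convergence of the partial
    sums of tilde T even for a last entry 1. *)
Lemma psum_cauchy k : positive_index k -> small (fun M K z => psum k M z - psum k K z).
Proof.
elim: k => [_|s k IH /andP[s1 k1]].
  by apply: eq_small (@small0 R) => M K z; rewrite !psum_nil subrr.
case: s s1 => // s _; elim: s => [|s IHs].
  apply: (small_primitive (f' := fun M K z => dpsum (1%N :: k) M z - dpsum (1%N :: k) K z)).
  - by move=> M K; rewrite !psum0 subrr.
  - by move=> M K z; apply: derB; apply: der_psum.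
  apply: eq_dsmall (dsmallD (dsmallM (B := 2) (h := fun _ _ z => 2 / (1 + z ^+ 2)) _
      (small_dsmall_id (IH k1)))
      (dsmallD (perr_dsmall k1) (dsmallN (perr_dsmall_r k1)))) => M K z _.
    by rewrite !dpsum_oneE; ring.
  exact: factor_bound.
apply: (small_primitive (f' := fun M K z => dpsum (s.+2 :: k) M z - dpsum (s.+2 :: k) K z)).
- by move=> M K; rewrite !psum0 subrr.
- by move=> M K z; apply: derB; apply: der_psum.
apply: eq_dsmall (small_dsmall IHs) => M K z /andP[z0 _].
by rewrite -!dpsum_succ; field; rewrite gt_eqF.
Qed.

End Indices.

Section Divided.
Variable R : realType.

Definition dpow (i : nat) (x : R) : R := x ^+ i / i`!%:R.

Lemma dpow0 x : dpow 0 x = 1. Proof. by rewrite /dpow expr0 divr1. Qed.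
Lemma dpowS0 i : dpow i.+1 0 = 0. Proof. by rewrite /dpow expr0n mul0r. Qed.

Lemma der_dpow i (x : R) : is_derive x 1 (dpow i.+1) (dpow i x).
Proof.
have := derMl (i.+1`!%:R)^-1 (derX i.+1 (der_id x)).
under eq_fun do rewrite mulrC.
move/der_eq; apply; rewrite /dpow mulr1 factS natrM /=.
have : i`!%:R != 0 :> R by rewrite pnatr_eq0 -lt0n fact_gt0.
have : i.+1%:R != 0 :> R by rewrite pnatr_eq0.
by move: (i.+1%:R : R) (i`!%:R : R) => a b a0 b0; field; rewrite a0 b0.
Qed.

Lemma dpow_le i (x B : R) : `|x| <= B -> `|dpow i x| <= dpow i B.
Proof.
move=> xB; rewrite /dpow normrM normfV (ger0_norm (ler0n _ _)) normrX.
by rewrite ler_pM2r ?invr_gt0 ?ltr0n ?fact_gt0 // lerXn2r ?nnegrE // (le_trans _ xB).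
Qed.

Definition theta (z : R) : R := 2 * atan z.
Definition cotheta (z : R) : R := pi / 2 - theta z.

Lemma der_theta (z : R) : is_derive z 1 theta (2 / (1 + z ^+ 2)).
Proof. exact: derMl (is_derive1_atan z). Qed.

Lemma der_cotheta (z : R) : is_derive z 1 cotheta (- (2 / (1 + z ^+ 2))).
Proof.
by apply: der_eq (derB (der_cst z (pi / 2)) (der_theta z)) _; rewrite sub0r.
Qed.

Lemma theta0 : theta 0 = 0. Proof. by rewrite /theta atan0 mulr0. Qed.
Lemma theta1 : theta 1 = pi / 2. Proof. by rewrite /theta atan1; field. Qed.
Lemma cotheta1 : cotheta 1 = 0. Proof. by rewrite /cotheta theta1 subrr. Qed.

Lemma theta_itv z : 0 <= z <= 1 -> 0 <= theta z <= pi / 2.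
Proof.
move=> /andP[z0 z1]; rewrite -theta1 -{1}theta0 /theta !ler_pM2l //.
by rewrite !le_atan.
Qed.

Lemma theta_le z : 0 <= z <= 1 -> theta z <= 2 * z.
Proof.
move=> z01; apply: le_trans (ler_norm _) _.
apply: (derivative_dominated der_theta (h := fun z => 2 * z) (h' := fun=> 2)) => //.
- by move=> x; apply: der_eq (derMl 2 (der_id x)) _; rewrite mulr1.
- exact: theta0.
- by rewrite mulr0.
- by move=> x _; apply: factor_bound.
Qed.

Lemma cotheta_bound z : 0 < z < 1 -> `|cotheta z| <= pi / 2.
Proof.
move=> /andP[z0 z1]; have /theta_itv : 0 <= z <= 1 by rewrite !ltW.
by rewrite /cotheta ler_norml => /andP[]; lra.
Qed.

Lemma dpow_cotheta_bound i z : 0 < z < 1 -> `|dpow i (cotheta z)| <= dpow i (pi / 2).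
Proof. by move=> z01; apply/dpow_le/cotheta_bound. Qed.

End Divided.

(** * The left-hand side as an iterated primitive *)

Section Telescope.
Variable R : realType.
Local Notation psum := (@psum R).
Local Notation dpsum := (@dpsum R).
Local Notation perr := (@perr R).
Local Notation dpow := (@dpow R).
Local Notation theta := (@theta R).
Local Notation cotheta := (@cotheta R).

Definition incr_last (k : seq nat) := if k is s :: k' then s.+1 :: k' else [::].

Lemma positive_nseq p k : positive_index k -> positive_index (nseq p 1%N ++ k).
Proof. by move=> k1; rewrite /positive_index all_cat all_nseq orbT. Qed.

Lemma positive_incr_last k : positive_index k -> positive_index (incr_last k).
Proof. by case: k => //= s k /andP[_ ->]. Qed.

Lemma dpsum_incr_last k M z : positive_index k -> (0 < size k)%N -> 0 < z ->
  dpsum (incr_last k) M z = psum k M z / z.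
Proof.
case: k => // -[|s] k // _ _ z0; rewrite -dpsum_succ mulrC mulKf // gt_eqF //.
Qed.

(* Differentiating in cotheta telescopes the sum over the last run of 1s. *)
Definition tail_sum (k : seq nat) (q M : nat) (z : R) : R :=
  \sum_(p < q.+1) psum (nseq p 1%N ++ k) M z * dpow (q - p) (cotheta z).

Definition tail_err (k : seq nat) (q M : nat) (z : R) : R :=
  \sum_(p < q) perr (nseq p 1%N ++ k) M z * dpow (q - p.+1) (cotheta z).

Lemma tail_sum0 k q M : (0 < size k)%N -> tail_sum k q M 0 = 0.
Proof.
move=> k0; rewrite /tail_sum big1 // => -[p _] _ /=.
by case: p => [|p]; [case: k k0 => // s k _|]; rewrite /= psum0 mul0r.
Qed.

(** [cotheta] vanishes at 1, so the sum collapses: up to truncation, integrating [dpsum k] against a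
    divided power of [cotheta] appends [q] entries 1 to the index. *)
Lemma tail_sum1 k q M : tail_sum k q M 1 = psum (nseq q 1%N ++ k) M 1.
Proof.
rewrite /tail_sum big_ord_recr /= subnn cotheta1 dpow0 mulr1 big1 ?add0r // => p _.
by rewrite /= -(subnSK (ltn_ord p)) /= dpowS0 mulr0.
Qed.

Lemma der_tail_sum k q M (z : R) : is_derive z 1 (tail_sum k q M)
  (dpsum k M z * dpow q (cotheta z) + tail_err k q M z).
Proof.
pose d p := dpow (q - p) (cotheta z).
pose u := 2 / (1 + z ^+ 2).
have dd p : is_derive z 1 (fun y => dpow (q - p) (cotheta y))
    (if (p < q)%N then - (u * dpow (q - p.+1) (cotheta z)) else 0).
  case: ltnP => pq.
    rewrite -(subnSK pq).
    by apply: der_eq (der_comp (der_dpow _ _) (der_cotheta z)) _; rewrite mulrN mulrC.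
  have -> : (q - p = 0)%N by lia.
  by under eq_fun do rewrite dpow0; apply: der_cst.
have := der_sum (index_enum 'I_q.+1)
  (fun p : 'I_q.+1 => derM (der_psum (nseq p 1%N ++ k) M z) (dd p)).
move/der_eq; apply; rewrite big_split /=.
rewrite big_ord_recr /= ltnn mulr0 addr0.
rewrite [X in _ + X]big_ord_recl /= subn0 addrCA mulrC; congr (_ + _).
rewrite -big_split /=; apply: eq_bigr => p _.
by rewrite ltn_ord /= dpsum_oneE /u; ring.
Qed.

Lemma tail_err_dsmall k q : positive_index k -> dsmall (fun M K z => tail_err k q M z).
Proof.
move=> k1; apply: dsmall_sum => p.
apply: (@eq_dsmall _ (fun M K z => dpow (q - p.+1) (cotheta z) * perr (nseq p 1%N ++ k) M z)).
  by move=> *; rewrite mulrC.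
apply: dsmallM (perr_dsmall (positive_nseq p k1)) => M K z.
exact: dpow_cotheta_bound.
Qed.

Lemma psum_ones m : small (fun M K z => psum (nseq m 1%N) M z - dpow m (theta z)).
Proof.
elim: m => [|m IH].
  by apply: eq_small (@small0 R) => M K z; rewrite psum_nil dpow0 subrr.
apply: (@small_primitive _ _ (fun M K z => dpsum (nseq m.+1 1%N) M z - dpow m (theta z) * (2 / (1 + z ^+ 2)))).
- by move=> M K; rewrite psum0 theta0 dpowS0 subrr.
- by move=> M K z; apply: derB; [apply: der_psum|apply: der_comp (der_dpow _ _) (der_theta z)].
apply: eq_dsmall (dsmallD (dsmallM (B := 2) (h := fun _ _ z => 2 / (1 + z ^+ 2)) _
      (small_dsmall_id IH)) (perr_dsmall (k := nseq m 1%N) _)) => [M K z _||].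
- by rewrite /= dpsum_oneE; ring.
- by move=> *; apply: factor_bound.
- by rewrite -[nseq m _]cats0; apply: positive_nseq.
Qed.

Variables (n : nat) (g : nat -> R).

Definition bernstein (x y : R) : R := \sum_(m < n.+1) g m * (dpow m x * dpow (n - m) y).

(** Up to truncation errors, [inner_sum] is the primitive of [bernstein (theta z) (cotheta z) / z],
    and [outer_sum] that of [inner_sum / z]. The value of [outer_sum] at 1 is a partial sum of the
    left-hand side. *)
Definition inner_sum (M : nat) (z : R) : R :=
  \sum_(i < n) g i.+1 * tail_sum (incr_last (nseq i.+1 1%N)) (n - i.+1) M z.

Definition outer_sum (M : nat) (z : R) : R :=
  \sum_(i < n) g i.+1 * \sum_(p < (n - i.+1).+1)
    tail_sum (incr_last (nseq p 1%N ++ incr_last (nseq i.+1 1%N))) (n - i.+1 - p) M z.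

(** The comparison functions, left abstract: [F] approximates the integrand, [Y] and [U] are its
    successive primitives with respect to dz/z. Fourier sums will be put in their place. *)
Variables (F Y Y' U U' : nat -> R -> R).
Hypothesis g0 : g 0%N = 0.
Hypothesis FP : small (fun M K z => bernstein (theta z) (cotheta z) - F K z).
Hypothesis Y0 : forall K, Y K 0 = 0.
Hypothesis U0 : forall K, U K 0 = 0.
Hypothesis dY : forall K (z : R), is_derive z 1 (Y K) (Y' K z).
Hypothesis dU : forall K (z : R), is_derive z 1 (U K) (U' K z).
Hypothesis Y'E : forall K z, 0 < z < 1 -> Y' K z = F K z / z.
Hypothesis U'E : forall K z, 0 < z < 1 -> U' K z = Y K z / z.

Lemma inner_sum_small : small (fun M K z => inner_sum M z - Y K z).
Proof.
have pos i : positive_index (incr_last (nseq i.+1 1%N)).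
  by apply: positive_incr_last; rewrite -[nseq _ _]cats0; apply: positive_nseq.
pose D M z := \sum_(i < n) g i.+1 * (dpsum (incr_last (nseq i.+1 1%N)) M z * dpow (n - i.+1) (cotheta z)
  + tail_err (incr_last (nseq i.+1 1%N)) (n - i.+1) M z).
apply: (@small_primitive _ _ (fun M K z => D M z - Y' K z)).
- by move=> M K; rewrite Y0 subr0 /inner_sum big1 // => i _; rewrite tail_sum0 ?mulr0.
- move=> M K z; apply: derB => //; apply: der_sum => i; apply: derMl; exact: der_tail_sum.
pose E1 (i : 'I_n) (M K : nat) z := g i.+1 * dpow (n - i.+1) (cotheta z) *
  ((psum (nseq i.+1 1%N) M z - dpow i.+1 (theta z)) / z).
pose E2 (i : 'I_n) (M K : nat) z := g i.+1 * tail_err (incr_last (nseq i.+1 1%N)) (n - i.+1) M z.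
have E1s i : dsmall (E1 i).
  apply: (dsmallM (B := `|g i.+1| * dpow (n - i.+1) (pi / 2))) (small_dsmall (psum_ones i.+1)).
  by move=> M K z z01; rewrite normrM ler_wpM2l // dpow_cotheta_bound.
have E2s i : dsmall (E2 i).
  by apply: (dsmallM (B := `|g i.+1|) (h := fun _ _ _ => g i.+1)) (tail_err_dsmall _ (pos i)).
apply: eq_dsmall (dsmallD (dsmallD (dsmall_sum (index_enum 'I_n) E1s)
   (dsmall_sum (index_enum 'I_n) E2s)) (small_dsmall FP)) => M K z z01.
have /andP[z0 z1] := z01.
(* The term [m = 0] would leave a pole at 0; [g0] removes it. *)
rewrite Y'E // /bernstein big_ord_recl /= g0 mul0r add0r mulrBl addrA; congr (_ - _).
rewrite mulr_suml -!big_split /=; apply: eq_bigr => i _.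
rewrite /E1 /E2 dpsum_incr_last ?size_nseq //; last by rewrite -[nseq _ _]cats0; apply: positive_nseq.
by rewrite /=; ring.
Qed.

Lemma outer_sum_small : small (fun M K z => outer_sum M z - U K z).
Proof.
have pos i : positive_index (incr_last (nseq i.+1 1%N)).
  by apply: positive_incr_last; rewrite -[nseq _ _]cats0; apply: positive_nseq.
have pos2 p i := positive_nseq p (pos i).
pose k p i := incr_last (nseq p 1%N ++ incr_last (nseq i.+1 1%N)).
have sz p i : (0 < size (nseq p 1%N ++ incr_last (nseq i.+1 1%N)))%N by rewrite size_cat /= addnS.
pose D M z := \sum_(i < n) g i.+1 * \sum_(p < (n - i.+1).+1)
  (dpsum (k p i) M z * dpow (n - i.+1 - p) (cotheta z) + tail_err (k p i) (n - i.+1 - p) M z).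
apply: (@small_primitive _ _ (fun M K z => D M z - U' K z)).
- move=> M K; rewrite U0 subr0 /outer_sum big1 // => i _; rewrite big1 ?mulr0 // => p _.
  by rewrite tail_sum0 //; case: (nseq _ _ ++ _) (sz p i).
- move=> M K z; apply: derB => //; apply: der_sum => i; apply: derMl; apply: der_sum => p.
  exact: der_tail_sum.
pose E (i : 'I_n) (M K : nat) z := g i.+1 * \sum_(p < (n - i.+1).+1) tail_err (k p i) (n - i.+1 - p) M z.
have Es i : dsmall (E i).
  apply: (dsmallM (B := `|g i.+1|) (h := fun _ _ _ => g i.+1)) => //.
  by apply: dsmall_sum => p; apply: tail_err_dsmall; apply: positive_incr_last.
apply: eq_dsmall (dsmallD (dsmall_sum (index_enum 'I_n) Es) (small_dsmall inner_sum_small)) => M K z z01.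
have /andP[z0 z1] := z01.
rewrite U'E // mulrBl addrA; congr (_ - _).
rewrite /inner_sum mulr_suml -big_split /=; apply: eq_bigr => i _.
rewrite /E -mulrA -mulrDr; congr (_ * _); rewrite /tail_sum mulr_suml -big_split /=.
by apply: eq_bigr => p _; rewrite dpsum_incr_last //; ring.
Qed.

End Telescope.

(** * Fourier expansion *)

Section Trigonometry.
Variable R : realType.
Implicit Types x z : R.

Lemma sin_theta z : sin (theta z) = 2 * z / (1 + z ^+ 2).
Proof.
have c0 : cos (atan z) != 0.
  by rewrite gt_eqF // cos_gt0_pihalf // atan_gtNpi2 atan_ltpi2.
have := cos2_tan2 c0; rewrite atanK => <-.
rewrite invrK /theta mulr_natl sin_mulr2n -{3}(atanK z) /tan.
by rewrite mulr2n; field.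
Qed.

(** With [sum_cos_even], a Dirichlet kernel: it divides the sine of a multiple angle by [sin x], so
    that each integration against dtheta/sin(theta) becomes a termwise integration of cosines. *)
Lemma sum_cos_odd x L :
  2 * sin x * \sum_(l < L) cos ((l.*2.+1)%:R * x) = sin ((L.*2)%:R * x).
Proof.
elim: L => [|L IH]; first by rewrite big_ord0 mulr0 mul0r sin0.
rewrite big_ord_recr /= mulrDr IH.
have -> : (L.*2)%:R * x = (L.*2.+1)%:R * x - x by rewrite -[in RHS]natr1; ring.
have -> : (L.+1.*2)%:R * x = (L.*2.+1)%:R * x + x by rewrite doubleS -[in LHS]natr1; ring.
by rewrite sinB sinD; ring.
Qed.

Lemma sum_cos_even x L :
  sin x * (1 + 2 * \sum_(j < L) cos ((j.+1.*2)%:R * x)) = sin ((L.*2.+1)%:R * x).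
Proof.
elim: L => [|L IH]; first by rewrite big_ord0 mulr0 addr0 mulr1 mul1r.
rewrite big_ord_recr /= !mulrDr addrA -mulrDr IH.
have -> : (L.*2.+1)%:R * x = (L.+1.*2)%:R * x - x by rewrite doubleS -[in RHS]natr1; ring.
have -> : (L.+1.*2.+1)%:R * x = (L.+1.*2)%:R * x + x by rewrite -[in LHS]natr1; ring.
by rewrite sinB sinD; ring.
Qed.

Lemma sin_natpi n : sin (n%:R * pi) = 0 :> R.
Proof.
by rewrite mulr_natl -[_ *+ _]add0r (alternatingn (@sinDpi R)) sin0 mulr0.
Qed.

Definition freq (i : nat) : R := (4 * i + 2)%:R.

Lemma freq_gt0 i : 0 < freq i. Proof. by rewrite ltr0n addn2. Qed.
Lemma freq_neq0 i : freq i != 0. Proof. by rewrite gt_eqF ?freq_gt0. Qed.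

Lemma freq_half i x : freq i * x = (i.*2.+1)%:R * (2 * x).
Proof. by rewrite mulrA -natrM; congr (_%:R * _); lia. Qed.

Lemma sin_freq_pihalf i : sin (freq i * (pi / 2)) = 0.
Proof.
by rewrite freq_half (_ : 2 * (pi / 2) = pi) ?sin_natpi //; field.
Qed.

Lemma cos_freq_reflect i x : cos (freq i * (pi / 2 - x)) = - cos (freq i * x).
Proof.
have -> : freq i * (pi / 2 - x) = - (freq i * x) + pi *+ i.*2.+1.
  rewrite -[pi *+ _]mulr_natl mulrBr (freq_half i (pi / 2)) addrC; congr (_ + _ * _); by field.
by rewrite (alternatingn (@cosDpi R)) cosN exprS -signr_odd odd_double mulN1r expr0 mulNr mul1r.
Qed.

Lemma freq_piquarter i : freq i * (pi / 4) = pi / 2 + pi *+ i.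
Proof. by rewrite -[pi *+ _]mulr_natl /freq natrD natrM; field. Qed.

Lemma cos_freq_piquarter i : cos (freq i * (pi / 4)) = 0.
Proof. by rewrite freq_piquarter (alternatingn (@cosDpi R)) cos_pihalf mulr0. Qed.

Lemma sin_freq_piquarter i : sin (freq i * (pi / 4)) = (-1) ^+ i.
Proof. by rewrite freq_piquarter (alternatingn (@sinDpi R)) sin_pihalf mulr1. Qed.

Definition sin_sum (n K : nat) x : R := 4 * \sum_(i < K) sin (freq i * x) / freq i ^+ n.
Definition cos_sum (n K : nat) x : R := 4 * \sum_(i < K) cos (freq i * x) / freq i ^+ n.

Lemma der_scale (c x : R) : is_derive x 1 (fun y => c * y) c.
Proof. by apply: der_eq (derMl c (der_id x)) _; rewrite mulr1. Qed.

Lemma der_sin_sum n K x : is_derive x 1 (sin_sum n.+1 K) (cos_sum n K x).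
Proof.
apply: derMl.
have -> : (fun z : R => \sum_(i < K) sin (freq i * z) / freq i ^+ n.+1) =
  (fun z => \sum_(i < K) (freq i ^+ n.+1)^-1 * sin (freq i * z)).
  by apply/funext => z; apply: eq_bigr => i _; rewrite mulrC.
apply: der_sum => i; apply: der_eq (derMl _ (der_comp (is_derive_sin _) (der_scale _ _))) _.
by rewrite exprS; move: (freq i) (freq_neq0 i) => w w0; field; rewrite expf_neq0 ?w0.
Qed.

Lemma der_cos_sum n K x : is_derive x 1 (cos_sum n.+1 K) (- sin_sum n K x).
Proof.
rewrite /sin_sum -mulrN -sumrN; apply: derMl.
have -> : (fun z : R => \sum_(i < K) cos (freq i * z) / freq i ^+ n.+1) =
  (fun z => \sum_(i < K) (freq i ^+ n.+1)^-1 * cos (freq i * z)).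
  by apply/funext => z; apply: eq_bigr => i _; rewrite mulrC.
apply: der_sum => i; apply: der_eq (derMl _ (der_comp (is_derive_cos _) (der_scale _ _))) _.
by rewrite exprS; move: (freq i) (freq_neq0 i) => w w0; field; rewrite expf_neq0 ?w0.
Qed.

Lemma sin_sum_0 n K : sin_sum n K 0 = 0.
Proof. by rewrite /sin_sum big1 ?mulr0 // => i _; rewrite mulr0 sin0 mul0r. Qed.

Lemma sin_sum_pihalf n K : sin_sum n K (pi / 2) = 0.
Proof. by rewrite /sin_sum big1 ?mulr0 // => i _; rewrite sin_freq_pihalf mul0r. Qed.

Lemma cos_sum0E K x : sin (2 * x) * cos_sum 0 K x = 2 * sin ((K.*2)%:R * (2 * x)).
Proof.
rewrite -sum_cos_odd /cos_sum mulrCA (_ : 4 = 2 * 2 :> R); last by ring.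
rewrite !mulrA; congr (_ * _); apply: eq_bigr => i _.
by rewrite freq_half expr0 divr1.
Qed.

(** The primitive of [sin_sum n K (theta z) / z]. The 8 is the 4 of [sin_sum] times the 2 of the
    Dirichlet kernel, and [freq i] is twice [i.*2.+1], the number of cosines. *)
Definition double_sum (n K : nat) (z : R) : R :=
  \sum_(i < K) 8 / freq i ^+ n *
    \sum_(l < i.*2.+1) (l.*2.+1)%:R^-1 * sin ((l.*2.+1)%:R * theta z).

Definition ddouble_sum (n K : nat) (z : R) : R :=
  \sum_(i < K) 8 / freq i ^+ n *
    \sum_(l < i.*2.+1) cos ((l.*2.+1)%:R * theta z) * (2 / (1 + z ^+ 2)).

Lemma der_double_sum n K (z : R) : is_derive z 1 (double_sum n K) (ddouble_sum n K z).
Proof.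
apply: der_sum => i; apply: derMl; apply: der_sum => l.
apply: der_eq (derMl _ (der_comp (is_derive_sin _) (derMl _ (der_theta z)))) _.
have l0 : l.*2.+1%:R != 0 :> R by rewrite pnatr_eq0.
by move: (l.*2.+1%:R : R) l0 => a a0; field; rewrite oneDsqr_neq0 a0.
Qed.

Lemma ddouble_sumE n K (z : R) : 0 < z < 1 ->
  ddouble_sum n K z = sin_sum n K (theta z) / z.
Proof.
move=> /andP[z0 z1]; rewrite /ddouble_sum /sin_sum mulr_sumr mulr_suml.
apply: eq_bigr => i _; rewrite -mulr_suml.
have z00 : z != 0 by rewrite gt_eqF.
have n0 := oneDsqr_neq0 z.
have := sum_cos_odd (theta z) i.*2.+1; rewrite sin_theta.
have -> : (i.*2.+1.*2)%:R = freq i by congr (_%:R); lia.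
move=> <-; move: (freq i ^+ n) (expf_neq0 n (freq_neq0 i)) => w w0; field.
by rewrite z00 n0 w0.
Qed.

Definition triple_sum (n K : nat) (z : R) : R :=
  \sum_(i < K) 8 / freq i ^+ n *
    \sum_(l < i.*2.+1) (l.*2.+1)%:R^-1 *
      (theta z + \sum_(j < l) (j.+1)%:R^-1 * sin ((j.+1.*2)%:R * theta z)).

Definition dtriple_sum (n K : nat) (z : R) : R :=
  \sum_(i < K) 8 / freq i ^+ n *
    \sum_(l < i.*2.+1) (l.*2.+1)%:R^-1 *
      ((1 + 2 * \sum_(j < l) cos ((j.+1.*2)%:R * theta z)) * (2 / (1 + z ^+ 2))).

Lemma der_triple_sum n K (z : R) : is_derive z 1 (triple_sum n K) (dtriple_sum n K z).
Proof.
apply: der_sum => i; apply: derMl; apply: der_sum => l; apply: derMl.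
apply: der_eq (derD (der_theta z) (der_sum _ (fun j : 'I_l => derMl _
  (der_comp (is_derive_sin _) (derMl _ (der_theta z)))))) _.
rewrite [RHS]mulrDl mul1r; congr (_ + _); rewrite mulr_sumr mulr_suml; apply: eq_bigr => j _.
have j0 : j.+1%:R != 0 :> R by rewrite pnatr_eq0.
rewrite -[j.+1.*2]muln2 natrM; move: (j.+1%:R : R) j0 => a a0; field.
by rewrite oneDsqr_neq0 a0.
Qed.

Lemma dtriple_sumE n K (z : R) : 0 < z < 1 ->
  dtriple_sum n K z = double_sum n K z / z.
Proof.
move=> /andP[z0 z1]; rewrite /dtriple_sum /double_sum mulr_suml.
apply: eq_bigr => i _; rewrite -[RHS]mulrA; congr (_ * _); rewrite mulr_suml.
apply: eq_bigr => l _; rewrite -[RHS]mulrA; congr (_ * _).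
rewrite -sum_cos_even sin_theta; field.
by rewrite oneDsqr_neq0 gt_eqF.
Qed.

Lemma double_sum0 n K : double_sum n K 0 = 0.
Proof.
by rewrite /double_sum big1 // => i _; rewrite big1 ?mulr0 // => l _; rewrite theta0 mulr0 sin0 mulr0.
Qed.

Lemma triple_sum0 n K : triple_sum n K 0 = 0.
Proof.
rewrite /triple_sum big1 // => i _; rewrite big1 ?mulr0 // => l _; rewrite theta0 add0r.
by rewrite big1 ?mulr0 // => j _; rewrite mulr0 sin0 mulr0.
Qed.

(** All sines are taken at multiples of pi and vanish; only the constant term of the even kernel
    survives and yields the factor pi/2, that is tilde T(1). *)
Lemma triple_sum1 n K : triple_sum n K 1 =
  pi / 2 * \sum_(i < K) 8 / freq i ^+ n * \sum_(l < i.*2.+1) (l.*2.+1)%:R^-1.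
Proof.
rewrite /triple_sum mulr_sumr; apply: eq_bigr => i _; rewrite mulrCA; congr (_ * _).
rewrite mulr_sumr; apply: eq_bigr => l _; rewrite theta1 big1 ?addr0; [by rewrite mulrC|move=> j _].
have -> : (j.+1.*2)%:R * (pi / 2) = j.+1%:R * pi :> R by rewrite -muln2 natrM; field.
by rewrite sin_natpi mulr0.
Qed.

End Trigonometry.

(** * Convergence for the square wave and its primitive *)

Section Fourier.
Variable R : realType.
Implicit Types x z e : R.

Lemma derV (f : R -> R) (x a : R) : f x != 0 -> is_derive x 1 f a ->
  is_derive x 1 (fun z => (f z)^-1) (- (f x) ^- 2 * a).
Proof. exact: is_deriveV. Qed.

Lemma der_reflect x : is_derive x 1 (fun y : R => pi / 2 - y) (- 1).
Proof. by apply: der_eq (derB (der_cst x (pi / 2)) (der_id x)) _; rewrite sub0r. Qed.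

(** The derivative lowers the degree and takes differences of the coefficients, so the second
    derivative involves just the second difference in [dumont_count_rec]. *)
Lemma der_bernstein n (g : nat -> R) x :
  is_derive x 1 (fun y => bernstein n.+1 g y (pi / 2 - y))
    (bernstein n (fun m => g m.+1 - g m) x (pi / 2 - x)).
Proof.
pose d m y : R := if m is m'.+1 then dpow m' y else 0.
have dd m (y : R) : is_derive y 1 (dpow m : R -> R) (d m y).
  case: m => [|m]; last exact: der_dpow.
  by rewrite (_ : dpow 0 = fun=> 1) ?(funext (@dpow0 R)) //; apply: der_cst.
have ddr m : is_derive x 1 (fun y => dpow m (pi / 2 - y)) (- d m (pi / 2 - x)).
  by apply: der_eq (der_comp (dd m _) (der_reflect x)) _; rewrite mulrN1.
have := der_sum (index_enum 'I_n.+2)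
  (fun m : 'I_n.+2 => derMl (g m) (derM (dd m x) (ddr (n.+1 - m)%N))).
move/der_eq; apply; rewrite /bernstein.
under eq_bigr => m _ do rewrite mulrDr addrC.
rewrite big_split /= big_ord_recl mulr0 !mulr0 add0r.
rewrite [X in _ + X]big_ord_recr /= subnn oppr0 !mulr0 addr0.
rewrite -big_split /=; apply: eq_bigr => m _.
have -> : (n.+1 - m = (n - m).+1)%N by rewrite subSn // -ltnS.
rewrite /= add0n subSS; ring.
Qed.

Lemma bernstein_0 n (g : nat -> R) (y : R) : g 0%N = 0 -> bernstein n g 0 y = 0.
Proof.
move=> g0; rewrite /bernstein big_ord_recl g0 mul0r add0r big1 // => i _.
by rewrite /= dpowS0 mul0r mulr0.
Qed.

Lemma bernstein_r0 n (g : nat -> R) x : g n = 0 -> bernstein n g x 0 = 0.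
Proof.
move=> gn; rewrite /bernstein big_ord_recr /= gn mul0r addr0 big1 // => i _.
by rewrite /= -(subnSK (ltn_ord i)) dpowS0 !mulr0.
Qed.

(** At pi/4 the sine sum is a partial sum of the Leibniz series, hence of tilde T(1), whose limit
    [psum_ones] provides. *)
Lemma leibniz_partial K : sin_sum 1 K (pi / 4 : R) = psum [:: 1%N] K.*2 1.
Proof.
have c0 m : tcoef R [::] m.+1 = 0 by [].
have altE m : alt (tcoef R [::]) m.*2 = 0 /\ alt (tcoef R [::]) m.*2.+1 = (-1) ^+ m.
  elim: m => [|m [IH0 IH1]]; first by rewrite altS alt0 subr0 expr0.
  have E : alt (tcoef R [::]) m.+1.*2 = 0 by rewrite doubleS altS c0 succnK IH0 subr0.
  by split=> //; rewrite doubleS altS c0 succnK IH1 sub0r exprS mulN1r.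
rewrite /sin_sum mulr_sumr; elim: K => [|K IH].
  by rewrite big_ord0 /psum big_ord1 tcoef_cons0 mul0r.
rewrite big_ord_recr IH doubleS !psumS /= !expr1n !mulr1 !tcoef_cons.
have [_ ->] := altE K; have := altE K.+1; rewrite doubleS => -[-> _].
rewrite mulr0 mul0r addr0 sin_freq_piquarter !expr1; congr (_ + _).
have -> : freq R K = 2 * (K.*2.+1)%:R by rewrite -natrM; congr (_%:R); lia.
have : K.*2.+1%:R != 0 :> R by rewrite pnatr_eq0.
by move: (K.*2.+1%:R : R) => a a0; field.
Qed.

(** The errors for the square wave and, up to sign, for its primitive vanishing at pi/4. In the case
    [n = 3], [rem2] is the first derivative of the error and [- rem1] the second. *)
Definition rem1 K x : R := pi / 2 - sin_sum 1 K x.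
Definition rem2 K x : R := pi / 2 * (pi / 4 - x) - cos_sum 2 K x.

Lemma rem1_piquarter e : 0 < e -> exists N, forall K, (N <= K)%N -> `|rem1 K (pi / 4)| <= e.
Proof.
move=> e0; have [N H] := @psum_ones R 1 e e0; exists N => K NK.
have NK2 : (N <= K.*2)%N by rewrite -addnn (leq_trans NK) ?leq_addl.
have := H K.*2 K.*2 NK2 NK2 1; rewrite ler01 lexx => /(_ isT).
rewrite mulr1 /= theta1 /dpow expr1 divr1 -leibniz_partial distrC.
by [].
Qed.

Lemma der_rem2 K x : is_derive x 1 (rem2 K) (- rem1 K x).
Proof.
apply: der_eq (derB (derMl (pi / 2) (derB (der_cst x (pi / 4)) (der_id x))) (der_cos_sum 1 K x)) _.
by rewrite /rem1; ring.
Qed.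

Lemma rem2_piquarter K : rem2 K (pi / 4) = 0.
Proof.
rewrite /rem2 subrr mulr0 sub0r /cos_sum big1 ?mulr0 ?oppr0 // => i _.
by rewrite cos_freq_piquarter mul0r.
Qed.

Lemma rem2_reflect K x : rem2 K (pi / 2 - x) = - rem2 K x.
Proof.
rewrite /rem2; have -> : cos_sum 2 K (pi / 2 - x) = - cos_sum 2 K x.
  rewrite /cos_sum -mulrN -sumrN; congr (_ * _); apply: eq_bigr => i _.
  by rewrite cos_freq_reflect mulNr.
by field.
Qed.

Lemma sin2_ge x t : 0 < x -> x <= t <= pi / 4 -> 0 < sin (2 * x) <= sin (2 * t).
Proof.
move=> x0 /andP[xt t4]; have p0 := pi_gt0 R.
have s0 : 0 < sin (2 * x) by apply: sin_gt0_pi; lra.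
rewrite s0 /=; move: xt; rewrite le_eqVlt => /predU1P[->|xt]; first exact: lexx.
by apply/ltW; rewrite ltr_sin ?in_itv /=; lra.
Qed.

(* Integration by parts: subtracting q from rem1 turns the derivative
   - 2 sin(k 2u)/sin(2u), with k = 2K, into one of size O(1/k). *)
Lemma rem1_bound K x t : (0 < K)%N -> 0 < x -> x <= t <= pi / 4 ->
  `|rem1 K t| <= `|rem1 K (pi / 4)| + 4 / (K.*2%:R * sin (2 * x) ^+ 2).
Proof.
move=> K0 x0 /andP[xt t4]; set s := sin (2 * x); set k : R := K.*2%:R.
have k0 : 0 < k by rewrite ltr0n double_gt0.
have sP u : t <= u <= pi / 4 -> 0 < s <= sin (2 * u).
  by move=> /andP[tu u4]; apply: sin2_ge => //; rewrite u4 (le_trans xt).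
have s0 : 0 < s by have /andP[] : 0 < s <= sin (2 * t) by apply: sP; rewrite lexx.
have s1 : s <= 1 := sin_le1 _.
pose q u := cos (k * (2 * u)) * (k * sin (2 * u))^-1.
pose dq u := - (2 * sin (k * (2 * u)) / sin (2 * u)) - 2 * cos (k * (2 * u)) * cos (2 * u) / (k * sin (2 * u) ^+ 2).
have dqE u : t <= u <= pi / 4 -> is_derive u 1 q (dq u).
  move=> /sP /andP[_ su]; have su0 : sin (2 * u) != 0 by rewrite gt_eqF // (lt_le_trans s0).
  have k00 : k != 0 by rewrite gt_eqF.
  have d2 := der_scale 2 u.
  have ks0 : (fun u => k * sin (2 * u)) u != 0 by rewrite mulf_neq0.
  have dc : is_derive u 1 (fun u => cos (k * (2 * u))) (- sin (k * (2 * u)) * (k * 2)).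
    exact: der_comp (is_derive_cos _) (derMl k d2).
  have ds : is_derive u 1 (fun u => k * sin (2 * u)) (k * (cos (2 * u) * 2)).
    exact: derMl k (der_comp (is_derive_sin _) d2).
  apply: der_eq (derM dc (@derV (fun u => k * sin (2 * u)) u _ ks0 ds)) _.
  by rewrite /dq; field; rewrite su0 k00.
have qb u : t <= u <= pi / 4 -> `|q u| <= (k * s ^+ 2)^-1.
  move=> /sP /andP[_ su]; rewrite /q normrM -[leRHS]mul1r ler_pM ?cos_max //.
  have ksu : 0 < k * sin (2 * u) by rewrite mulr_gt0 // (lt_le_trans s0).
  rewrite normfV gtr0_norm // lef_pV2 ?posrE //; last by rewrite mulr_gt0 ?exprn_gt0.
  by rewrite ler_pM2l //; apply: le_trans su; rewrite expr2 ler_piMr ?(ltW s0).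
have mv := @mean_value_bound R (fun u => rem1 K u - q u) (fun u => - cos_sum 0 K u - dq u) t (pi / 4) (2 / (k * s ^+ 2)) t4.
have d1 (u : R) : is_derive u 1 (rem1 K) (- cos_sum 0 K u).
  by apply: der_eq (derB (der_cst u (pi / 2)) (der_sin_sum 0 K u)) _; rewrite sub0r.
have {mv} := mv (fun u tu => derB (d1 u) (dqE u tu)).
have dqb u : t < u < pi / 4 -> `|- cos_sum 0 K u - dq u| <= 2 / (k * s ^+ 2).
  move=> /andP[tu u4].
  have /sP/andP[_ su] : t <= u <= pi / 4 by rewrite !ltW.
  have su0 : sin (2 * u) != 0 by rewrite gt_eqF // (lt_le_trans s0).
  have -> : - cos_sum 0 K u - dq u = 2 * (cos (k * (2 * u)) * cos (2 * u)) / (k * sin (2 * u) ^+ 2).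
    have -> : cos_sum 0 K u = 2 * sin (k * (2 * u)) / sin (2 * u).
      by rewrite -cos_sum0E mulrC mulKf.
    by rewrite /dq; ring.
  have ks2 : 0 < k * sin (2 * u) ^+ 2 by rewrite mulr_gt0 // exprn_gt0 // (lt_le_trans s0).
  rewrite normrM normfV (gtr0_norm ks2); apply: ler_pM; rewrite ?invr_ge0 ?(ltW ks2) //.
    rewrite !normrM ger0_norm // -[leRHS]mulr1 ler_pM2l // -[leRHS]mulr1.
    by apply: ler_pM; rewrite ?cos_max.
  rewrite lef_pV2 ?posrE //; last by rewrite mulr_gt0 ?exprn_gt0.
  by rewrite ler_pM2l // lerXn2r // nnegrE ltW // (lt_le_trans s0).
move=> /(_ dqb).
have qt := qb t; have q4 := qb (pi / 4).
have {}qt : `|q t| <= (k * s ^+ 2)^-1 by apply: qt; rewrite lexx.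
have {}q4 : `|q (pi / 4)| <= (k * s ^+ 2)^-1 by apply: q4; rewrite lexx andbT.
have p2 := pihalf_lt2 R.
move: qt q4; set v := (k * s ^+ 2)^-1 => qt q4.
have v0 : 0 <= v by rewrite invr_ge0 mulr_ge0 ?exprn_ge0 ?ltW.
(* The 4 consists of two boundary values of [q] and of twice [v] from the mean value bound, since
   pi/4 - t is at most 1. *)
have vp : v * (pi / 4 - t) <= v by rewrite ler_piMr //; lra.
rewrite -mulrA; move: qt q4.
move: (rem1 K t) (rem1 K (pi / 4)) (q t) (q (pi / 4)) => a b c d cv dv abcd.
have -> : a = b - (b - d - (a - c)) + (c - d) by ring.
apply: le_trans (ler_normD _ _) _; apply: le_trans (lerD (ler_normB _ _) (ler_normB _ _)) _.
lra.
Qed.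

(** Pointwise only, as the bound on [rem1] degenerates at 0. The base point pi/4 is where all
    cosines vanish. *)
Lemma rem2_cvg x e : 0 < x <= pi / 4 -> 0 < e ->
  exists N, forall K, (N <= K)%N -> `|rem2 K x| <= e.
Proof.
move=> /andP[x0 x4] e0; have e2 : 0 < e / 2 by rewrite divr_gt0.
have [N H] := rem1_piquarter e2.
have s0 : 0 < sin (2 * x) by have /andP[] : 0 < sin (2 * x) <= sin (2 * x) by apply: sin2_ge => //; rewrite lexx.
have p2 := pihalf_lt2 R.
pose B := 4 / (e / 2 * sin (2 * x) ^+ 2).
exists (maxn N.+1 (Num.truncn B).+1) => K; rewrite geq_max => /andP[NK BK].
have K0 : (0 < K)%N by apply: leq_trans NK.
have kB : 4 / (K.*2%:R * sin (2 * x) ^+ 2) <= e / 2.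
  rewrite ler_pdivrMr ?mulr_gt0 ?ltr0n ?double_gt0 ?exprn_gt0 //.
  rewrite mulrCA -ler_pdivrMr ?mulr_gt0 ?exprn_gt0 // -/B.
  apply: le_trans (ltW (truncnS_gt B)) _.
  by rewrite ler_nat; apply: leq_trans BK _; rewrite -addnn leq_addl.
have := @mean_value_bound R (rem2 K) (fun u => - rem1 K u) x (pi / 4) e x4 (fun u _ => der_rem2 K u).
have b1 u : x < u < pi / 4 -> `|- rem1 K u| <= e.
  move=> /andP[xu u4]; rewrite normrN; apply: le_trans (rem1_bound K0 x0 (_ : x <= u <= pi / 4)) _.
    by rewrite !ltW.
  by have := H K (ltnW NK); lra.
move=> /(_ b1); rewrite rem2_piquarter sub0r normrN => h; apply: le_trans h _.
by rewrite ler_piMr ?ltW //; lra.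
Qed.

(** The term of index k is at most 1/k - 1/(k+1), which telescopes to a bound free of [x]. *)
Lemma cos_sum_tail K L x : (0 < K)%N ->
  `|cos_sum 2 (K + L) x - cos_sum 2 K x| <= K%:R^-1 - (K + L)%:R^-1.
Proof.
move=> K0; elim: L => [|L IH]; first by rewrite addn0 !subrr normr0.
have -> : cos_sum 2 (K + L.+1) x = cos_sum 2 (K + L) x + 4 * (cos (freq R (K + L) * x) / freq R (K + L) ^+ 2).
  by rewrite addnS /cos_sum big_ord_recr mulrDr.
rewrite addnS addrAC.
apply: le_trans (ler_normD _ _) _.
have k0 : 0 < (K + L)%:R :> R by rewrite ltr0n addn_gt0 K0.
have : `|4 * (cos (freq R (K + L) * x) / freq R (K + L) ^+ 2)| <= (K + L)%:R^-1 - (K + L).+1%:R^-1.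
  have f0 : 0 <= 4 / freq R (K + L) ^+ 2 by rewrite divr_ge0 // exprn_ge0 // ltW ?freq_gt0.
  rewrite mulrCA normrM (ger0_norm f0); apply: le_trans (ler_piMl f0 (cos_max _)) _.
  have -> : freq R (K + L) = 4 * (K + L)%:R + 2 by rewrite /freq natrD natrM.
  rewrite -[(K + L).+1%:R]natr1; move: ((K + L)%:R : R) k0 => k k0.
  have -> : k^-1 - (k + 1)^-1 = (k * (k + 1))^-1.
    by field; rewrite !gt_eqF //; lra.
  rewrite ler_pdivrMr; last by rewrite exprn_gt0 //; lra.
  rewrite mulrC ler_pdivlMr; last by rewrite mulr_gt0 //; lra.
  by nra.
by move=> h; apply: le_trans (lerD IH h) _; rewrite addrA subrK.
Qed.

(** Pointwise convergence identifies the limit as 0, and the tail estimate then gives a rate that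
    does not depend on [x]; the reflection about pi/4 covers the other half. *)
Lemma rem2_uniform K x : (0 < K)%N -> 0 < x < pi / 2 -> `|rem2 K x| <= K%:R^-1.
Proof.
move=> K0; wlog x4 : x / x <= pi / 4.
  move=> h /andP[x0 x2]; have [x4|x4] := leP x (pi / 4); first by apply: h; rewrite ?x0.
  have := h (pi / 2 - x); rewrite rem2_reflect normrN; apply; first by lra.
  by apply/andP; split; lra.
move=> /andP[x0 _]; apply/ler_addgt0Pr => e e0.
have [|N H] := @rem2_cvg x e _ e0; first by rewrite x0.
have := H (K + N)%N (leq_addl _ _).
have := cos_sum_tail N x K0.
have -> : cos_sum 2 (K + N) x - cos_sum 2 K x = rem2 K x - rem2 (K + N) x by rewrite /rem2; ring.
have : 0 <= (K + N)%:R^-1 :> R by rewrite invr_ge0.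
move: (rem2 K x) (rem2 (K + N) x) => a b h1 h2 h3.
have -> : a = (a - b) + b by ring.
by apply: le_trans (ler_normD _ _) _; lra.
Qed.

End Fourier.

(** * Fourier series of the polynomials with Dumont coefficients *)

Section Fourier2.
Variable R : realType.
Implicit Types x z e : R.

Definition dumont_weight (n m : nat) : R := (dumont_count n m)%:R.

(** The polynomial is (pi/4) x (pi/2 - x) here. The bound is proportional to [x] so that it survives
    the division by z in dz/z. *)
Lemma fourier_base e : 0 < e -> exists N, forall K, (N <= K)%N ->
  forall x, 0 <= x <= pi / 2 ->
  `|bernstein 3 (dumont_weight 3) x (pi / 2 - x) - sin_sum 3 K x| <= e * x.
Proof.
move=> e0; exists (Num.truncn e^-1).+1 => K NK x /andP[x0 x2].
have K0 : (0 < K)%N by apply: leq_trans NK.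
have Ke : K%:R^-1 <= e.
  rewrite -[leRHS]invrK lef_pV2 ?posrE ?ltr0n ?invr_gt0 //.
  by apply: le_trans (ltW (truncnS_gt _)) _; rewrite ler_nat.
pose r x := bernstein 3 (dumont_weight 3) x (pi / 2 - x) - sin_sum 3 K x.
have dr z : is_derive (z : R) 1 r (rem2 K z).
  apply: der_eq (derB (der_bernstein 2 (dumont_weight 3) z) (der_sin_sum 2 K z)) _.
  congr (_ - _); rewrite /bernstein !big_ord_recr big_ord0 /= /dumont_weight.
  have [-> ->] := dumont_count_three; rewrite dumont_count0 dumont_count_max.
  by rewrite /dpow !factS fact0 /=; field.
have := @mean_value_bound R r (rem2 K) 0 x K%:R^-1 x0 (fun z _ => dr z).
have b z : 0 < z < x -> `|rem2 K z| <= K%:R^-1.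
  by move=> /andP[z0 zx]; apply: rem2_uniform; rewrite // z0 (lt_le_trans zx).
move=> /(_ b); rewrite subr0 {2}/r sin_sum_0 bernstein_0 ?subr0; last first.
  by rewrite /dumont_weight dumont_count0.
by move=> /le_trans; apply; rewrite ler_wpM2r.
Qed.

(** By the recurrence, the second derivative of the error for [n.+2] is minus the error for [n]. The
    quarter covers the bound pi/2 < 2, used twice. *)
Lemma fourier_step n : odd n -> (3 <= n)%N ->
  (forall e, 0 < e -> exists N, forall K, (N <= K)%N -> forall x, 0 <= x <= pi / 2 ->
    `|bernstein n (dumont_weight n) x (pi / 2 - x) - sin_sum n K x| <= e * x) ->
  forall e, 0 < e -> exists N, forall K, (N <= K)%N -> forall x, 0 <= x <= pi / 2 ->
    `|bernstein n.+2 (dumont_weight n.+2) x (pi / 2 - x) - sin_sum n.+2 K x| <= e * x.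
Proof.
move=> nodd n3 IH e e0; have [|N H] := IH (e / 4); first by rewrite divr_gt0.
exists N => K /H {}H x /andP[x0 x2].
pose g := dumont_weight n.+2.
pose g1 m := g m.+1 - g m; pose g2 m := g1 m.+1 - g1 m.
pose r x := bernstein n.+2 g x (pi / 2 - x) - sin_sum n.+2 K x.
pose r1 x := bernstein n.+1 g1 x (pi / 2 - x) - cos_sum n.+1 K x.
pose r2 x := bernstein n g2 x (pi / 2 - x) + sin_sum n K x.
have dr (z : R) : is_derive z 1 r (r1 z) by apply: derB; [apply: der_bernstein|apply: der_sin_sum].
have dr1 (z : R) : is_derive z 1 r1 (r2 z).
  by apply: der_eq (derB (der_bernstein n g1 z) (der_cos_sum n K z)) _; rewrite opprK.
have p0 := pihalf_ge1 R; have p2 := pihalf_lt2 R.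
have r2b z : 0 <= z <= pi / 2 -> `|r2 z| <= e / 2.
  move=> z02; have -> : r2 z = - (bernstein n (dumont_weight n) z (pi / 2 - z) - sin_sum n K z).
    rewrite opprB addrC /r2; congr (_ + _); rewrite /bernstein -sumrN; apply: eq_bigr => m _.
    rewrite -mulNr; congr (_ * _); rewrite /g2 /g1 /g /dumont_weight.
    have mn : (m <= n)%N by rewrite -ltnS.
    have /(congr1 (fun i => i%:R : R)) := dumont_count_rec nodd mn n3.
    by rewrite mul2n -addnn /= !natrD; lra.
  rewrite normrN; apply: le_trans (H z z02) _.
  have : e / 4 * z <= e / 4 * 2 by rewrite ler_pM2l ?divr_gt0 //; lra.
  by lra.
have r0 : r 0 = 0.
  by rewrite /r sin_sum_0 bernstein_0 ?subr0 // /g /dumont_weight dumont_count0.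
have rp : r (pi / 2) = 0.
  by rewrite /r sin_sum_pihalf subrr bernstein_r0 ?subr0 // /g /dumont_weight dumont_count_max.
have p20 : 0 < pi / 2 :> R by lra.
(* Rolle: the error vanishes at 0 and pi/2 because the extreme Dumont numbers do, so its derivative
   has a zero [c] from which it can be bounded. *)
have [|c] := @MVT R r r1 0 (pi / 2) p20 (fun z _ => dr z).
  by apply: derivable_within_continuous => z _; case: (dr z).
rewrite in_itv /= r0 rp !subr0 => /andP[c0 c2] /esym/eqP.
rewrite mulf_eq0 (gt_eqF p20) orbF => /eqP r1c.
have r1b z : 0 <= z <= pi / 2 -> `|r1 z| <= e.
  move=> /andP[z0 z2]; have [cz|/ltW zc] := leP c z.
    have := @mean_value_bound R r1 r2 c z (e / 2) cz (fun u _ => dr1 u).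
    have b u : c < u < z -> `|r2 u| <= e / 2 by move=> /andP[cu uz]; apply: r2b; apply/andP; split; lra.
    move=> /(_ b); rewrite r1c subr0 => /le_trans; apply.
    have : e / 2 * (z - c) <= e / 2 * 2 by rewrite ler_pM2l ?divr_gt0 //; lra.
    by lra.
  have := @mean_value_bound R r1 r2 z c (e / 2) zc (fun u _ => dr1 u).
  have b u : z < u < c -> `|r2 u| <= e / 2 by move=> /andP[cu uz]; apply: r2b; apply/andP; split; lra.
  move=> /(_ b); rewrite r1c sub0r normrN => /le_trans; apply.
  have : e / 2 * (c - z) <= e / 2 * 2 by rewrite ler_pM2l ?divr_gt0 //; lra.
  by lra.
have := @mean_value_bound R r r1 0 x e x0 (fun u _ => dr u).
have b u : 0 < u < x -> `|r1 u| <= e by move=> /andP[cu uz]; apply: r1b; apply/andP; split; lra.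
by move=> /(_ b); rewrite r0 !subr0.
Qed.

Lemma fourier n : odd n -> (3 <= n)%N ->
  forall e, 0 < e -> exists N, forall K, (N <= K)%N -> forall x, 0 <= x <= pi / 2 ->
    `|bernstein n (dumont_weight n) x (pi / 2 - x) - sin_sum n K x| <= e * x.
Proof.
move=> nodd n3; have [j ->] : exists j, n = j.*2.+3.
  by exists (n - 3)./2; have := odd_double_half (n - 3); rewrite oddB // nodd; lia.
elim: j => [|j IH]; first exact: fourier_base.
by rewrite doubleS; apply: fourier_step => //=; rewrite !negbK odd_double.
Qed.

Lemma outer_sum_fourier n : odd n -> (3 <= n)%N ->
  small (fun M K z => outer_sum n (dumont_weight n) M z - triple_sum n K z).
Proof.
move=> nodd n3.
apply: (@outer_sum_small R n (dumont_weight n) (fun K z => sin_sum n K (theta z))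
  (double_sum n) (ddouble_sum n) (triple_sum n) (dtriple_sum n)).
- by rewrite /dumont_weight dumont_count0.
(* Half, because [theta z] is at most [2 * z]. *)
- move=> e e0; have [|N H] := @fourier n nodd n3 (e / 2); first by rewrite divr_gt0.
  exists N => M K _ NK z z01; apply: le_trans (H K NK _ (theta_itv z01)) _.
  by have := theta_le z01; rewrite -(ler_pM2l (_ : 0 < e / 2)) ?divr_gt0 //; lra.
- exact: double_sum0.
- exact: triple_sum0.
- by move=> K z; apply: der_double_sum.
- by move=> K z; apply: der_triple_sum.
- by move=> K z; apply: ddouble_sumE.
- by move=> K z; apply: dtriple_sumE.
Qed.

End Fourier2.

(** * Multiple series as iterated sums *)

Section Chains.
Variable R : realType.

(** The index is read from its last entry, and [x] is the value of the last summation variable. For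
    the empty index, 0 plays the predecessor of m_1, as in [last_index]. *)
Fixpoint chain (k : seq nat) (x : nat) : R :=
  if k is s :: k' then
    if odd x == odd (size k) then (\sum_(y < x) chain k' y) / x%:R ^+ s else 0
  else (x == 0%N)%:R.

Definition widen_tuple (T : Type) r (t : r.+1.-tuple T) : r.-tuple T :=
  [tuple tnth t (widen_ord (leqnSn r) i) | i < r].

Lemma tnth_rcons_widen (T : Type) r (t : r.-tuple T) x i :
  tnth [tuple of rcons t x] (widen_ord (leqnSn r) i) = tnth t i.
Proof. by rewrite !(tnth_nth x) /= nth_rcons size_tuple ltn_ord. Qed.

Lemma tnth_rcons_max (T : Type) r (t : r.-tuple T) x :
  tnth [tuple of rcons t x] ord_max = x.
Proof. by rewrite (tnth_nth x) /= nth_rcons size_tuple ltnn eqxx. Qed.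

Lemma tuple_rconsE (T : Type) r (t : r.+1.-tuple T) :
  t = [tuple of rcons (widen_tuple t) (tnth t ord_max)].
Proof.
apply: eq_from_tnth => i; have [ir|ir] := ltnP i r.
  have -> : i = widen_ord (leqnSn r) (Ordinal ir) by apply: val_inj.
  by rewrite tnth_rcons_widen tnth_mktuple.
have -> : i = ord_max by apply: val_inj; apply/eqP; rewrite eqn_leq ir -ltnS ltn_ord.
by rewrite tnth_rcons_max.
Qed.

Lemma summation_range_rcons r M (t : r.-tuple 'I_M.+1) (x : 'I_M.+1) :
  summation_range [tuple of rcons t x] =
  [&& summation_range t, (last_index t < x)%N & odd x == odd r.+1].
Proof.
rewrite /summation_range /last_index map_rcons rcons_path -!andbA; congr (_ && _).
rewrite andbCA; congr (_ && _).
have E (a b : nat) : (a == b %[mod 2]) = (odd a == odd b).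
  by rewrite !modn2; case: (odd a); case: (odd b).
apply/forallP/andP => [H|[/forallP H Hx] j].
  split; first by apply/forallP => j; have := H (widen_ord (leqnSn r) j); rewrite tnth_rcons_widen.
  by have := H ord_max; rewrite tnth_rcons_max E.
have [jr|jr] := ltnP j r.
  have -> : j = widen_ord (leqnSn r) (Ordinal jr) by apply: val_inj.
  by rewrite tnth_rcons_widen; apply: H.
have -> : j = ord_max by apply: val_inj; apply/eqP; rewrite eqn_leq jr -ltnS ltn_ord.
by rewrite tnth_rcons_max E.
Qed.

Lemma summand_rcons r M (k : r.+1.-tuple nat) (t : r.-tuple 'I_M.+1) (x : 'I_M.+1) :
  summand R k [tuple of rcons t x] =
  summand R (widen_tuple k) t / x%:R ^+ tnth k ord_max.
Proof.
rewrite /summand big_ord_recr /= invfM tnth_rcons_max; congr (_^-1 * _).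
by apply: eq_bigr => i _; rewrite tnth_rcons_widen tnth_mktuple.
Qed.

Lemma rev_tuple_rcons r (k : r.+1.-tuple nat) :
  rev k = tnth k ord_max :: rev (widen_tuple k).
Proof. by rewrite {1}(tuple_rconsE k) /= rev_rcons. Qed.

(** [F] is general because the induction uses the indicator of [y < x]; later it is 1 for T and the
    sign for tilde T. *)
Lemma sum_tuple_chain r M (k : r.-tuple nat) (F : nat -> R) :
  \sum_(m : r.-tuple 'I_M.+1 | summation_range m) F (last_index m) * summand R k m =
  \sum_(x < M.+1) F x * chain (rev k) x.
Proof.
elim: r k F => [|r IH] k F.
  rewrite (big_pred1 [tuple]); last first.
    move=> m; rewrite [m]tuple0; transitivity true; last by symmetry; apply/eqP.
    by rewrite /summation_range /=; apply/forallP => -[].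
  rewrite [rev k](_ : _ = [::]); last by rewrite [k]tuple0.
  rewrite big_ord_recl big1 ?addr0; last by move=> i _; rewrite /= mulr0.
  by rewrite /summand big_ord0 invr1.
pose h (p : r.-tuple 'I_M.+1 * 'I_M.+1) := [tuple of rcons p.1 p.2] : r.+1.-tuple 'I_M.+1.
pose h' (t : r.+1.-tuple 'I_M.+1) := (widen_tuple t, tnth t ord_max).
have hK : cancel h h'.
  move=> [t x]; rewrite /h' /h tnth_rcons_max; congr pair.
  by apply: eq_from_tnth => i; rewrite tnth_mktuple tnth_rcons_widen.
have hK' : cancel h' h by move=> t; rewrite /h /h' /= -tuple_rconsE.
rewrite (reindex h); last by exists h' => ? _; [apply: hK|apply: hK'].
pose s := tnth k ord_max; pose w := widen_tuple k.
transitivity (\sum_(t : r.-tuple 'I_M.+1 | summation_range t)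
  \sum_(x < M.+1 | (last_index t < x)%N && (odd x == odd r.+1))
    F x * (summand R w t / x%:R ^+ s)).
  rewrite pair_big_dep; apply: eq_big => [[t x]|[t x] _].
    by rewrite summation_range_rcons.
  by rewrite summand_rcons /last_index /= map_rcons last_rcons.
under eq_bigr do rewrite big_mkcond.
rewrite exchange_big; apply: eq_bigr => x _.
have sw : size (rev w) = r by rewrite size_rev size_tuple.
rewrite rev_tuple_rcons -/w -/s [chain _ _]/= sw.
case: (odd x == ~~ odd r); last first.
  by rewrite mulr0 big1 // => t _; rewrite andbF.
have -> : \sum_(y < x) chain (rev w) y = \sum_(t : r.-tuple 'I_M.+1 | summation_range t)
    (last_index t < x)%N%:R * summand R w t.
  rewrite (IH w (fun y => (y < x)%N%:R)).
  rewrite (big_ord_widen M.+1 (chain (rev w))) ?(ltnW (ltn_ord x)) // big_mkcond.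
  by apply: eq_bigr => y _; case: ifP => _; rewrite ?mul1r ?mul0r.
rewrite mulrCA mulr_suml; apply: eq_bigr => t _.
by rewrite andbT; case: ifP => _; rewrite ?mul1r ?mul0r // mulrCA.
Qed.

Lemma chain_parity k x : odd x != odd (size k) -> chain k x = 0.
Proof.
case: k => [|s k] /=; first by case: x.
by move=> /negPf ->.
Qed.

Lemma chain_lt k x : (x < size k)%N -> chain k x = 0.
Proof.
elim: k x => // s k IH x /=; rewrite ltnS => xk.
case: ifP => // _; rewrite big1 ?mul0r // => y _; apply: IH.
exact: leq_trans (ltn_ord y) xk.
Qed.

(** For [y] and [x] of the right parity, the sign carried by [y] times the sign of [y] in [alt] does
    not depend on [y], so the alternating sum becomes a plain sum with one sign in front. *)
Lemma tcoef_chain k x :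
  tcoef R k x = 2 ^+ size k * (-1) ^+ (x - size k)./2 * chain k x.
Proof.
elim: k x => [|s k IH] x.
  by rewrite /tcoef /=; case: x => [|x] /=; rewrite ?mulr0 // expr0 !mulr1.
have altE : alt (tcoef R k) x = if odd x == odd (size k).+1 then
    2 ^+ size k * (-1) ^+ (x - (size k).+1)./2 * \sum_(y < x) chain k y else 0.
  have [n] := ubnP x; elim: n x => // n IHn [|[|x]].
  - by rewrite alt0 big_ord0 mulr0 if_same.
  - move=> _; rewrite altS alt0 subr0 IH big_ord1 subSS sub0n /=.
    case: (boolP (odd (size k))) => k_odd /=; last by [].
    by rewrite chain_parity ?mulr0 // k_odd.
  rewrite !ltnS => xn; rewrite altS succnK (IHn x); last exact: leq_trans xn.
  rewrite IH /= negbK; set r := size k.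
  case: ifP => [/eqP xr|/negbT xr]; last first.
    by rewrite chain_parity ?mulr0 ?subr0 //= -/r; move: xr; case: odd; case: odd.
  have chx : chain k x = 0 by rewrite chain_parity // xr -/r; case: odd.
  rewrite !big_ord_recr /= chx addr0 subSS mulrDr addrC; congr (_ + _).
  have [rx|xr'] := leqP r.+1 x.
    have -> : (x.+1 - r = (x - r.+1).+2)%N by lia.
    by rewrite /= exprS; ring.
  by rewrite big1 ?mulr0 ?oppr0 // => y _; apply: chain_lt; rewrite -/r; apply: leq_trans (ltn_ord y) _; rewrite -ltnS.
rewrite tcoef_cons altE [chain _ _]/=; case: ifP => _; last by rewrite !mulr0 mul0r.
by rewrite /= exprS; ring.
Qed.

Lemma partial_tildeT_psum r (k : r.-tuple nat) M :
  partial_tildeT R k M = psum (rev k) M 1.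
Proof.
rewrite /partial_tildeT.
rewrite (sum_tuple_chain M k (fun x => (-1) ^+ (x - r)./2)) mulr_sumr /psum.
apply: eq_bigr => x _; rewrite expr1n mulr1 tcoef_chain size_rev size_tuple.
by rewrite mulrA.
Qed.

Lemma partial_T_chain r (k : r.-tuple nat) M :
  partial_T R k M = 2 ^+ r * \sum_(x < M.+1) chain (rev k) x.
Proof.
rewrite /partial_T; congr (_ * _).
have := sum_tuple_chain M k (fun=> 1).
by under eq_bigr do rewrite mul1r; under [RHS]eq_bigr do rewrite mul1r.
Qed.

Lemma chain_one y : chain [:: 1%N] y = if odd y then y%:R^-1 else 0.
Proof.
rewrite /= eqb_id; case: y => [|y] //=; case: ifP => // _.
by rewrite big_ord_recl /= big1 ?addr0 ?mul1r.
Qed.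

Lemma chain_one_sum L : \sum_(y < L.*2) chain [:: 1%N] y = \sum_(l < L) (l.*2.+1)%:R^-1.
Proof.
elim: L => [|L IH]; first by rewrite !big_ord0.
rewrite doubleS !big_ord_recr /= -!/(chain [:: 1%N] _) !chain_one /= odd_double /= addr0.
by congr (_ + _).
Qed.

(** For m_2 = 2 mod 4 the terms of T and tilde T agree, for m_2 = 0 mod 4 they cancel. What survives
    is m_2 = [freq i], and [(M + 2) %/ 4] of these are at most [M]. *)
Lemma partial_sumE n M :
  partial_T R [tuple 1%N; n] M + partial_tildeT R [tuple 1%N; n] M =
  \sum_(i < (M + 2) %/ 4) 8 / freq R i ^+ n * \sum_(l < i.*2.+1) (l.*2.+1)%:R^-1.
Proof.
pose u x := 2 ^+ 2 * chain [:: n; 1%N] x + tcoef R [:: n; 1%N] x.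
have uE x : u x = if (x %% 4 == 2)%N then 8 / x%:R ^+ n * \sum_(y < x) chain [:: 1%N] y else 0.
  have -> : u x = 2 ^+ 2 * chain [:: n; 1%N] x + 2 ^+ 2 * (-1) ^+ (x - 2)./2 * chain [:: n; 1%N] x.
    by rewrite /u tcoef_chain.
  have -> : chain [:: n; 1%N] x = if odd x == false then (\sum_(y < x) chain [:: 1%N] y) / x%:R ^+ n else 0 by [].
  case: (boolP (odd x)) => x_odd /=; first by rewrite !mulr0 addr0 ifF //; lia.
  case: ifP => x4.
    have -> : ((x - 2)./2 = (x %/ 4).*2)%N by lia.
    by rewrite -signr_odd odd_double expr0 mulr1; ring.
  (* At 0 the truncated subtraction gives the wrong sign, but the inner sum is empty. *)
  case: x x_odd x4 => [|x] x_odd x4; first by rewrite big_ord0 mul0r !mulr0 addr0.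
  have -> : ((x.+1 - 2)./2 = (x.+1 %/ 4).-1.*2.+1)%N by lia.
  by rewrite -signr_odd /= odd_double expr1; ring.
have -> : partial_T R [tuple 1%N; n] M + partial_tildeT R [tuple 1%N; n] M = \sum_(x < M.+1) u x.
  rewrite big_split /= -mulr_sumr partial_T_chain partial_tildeT_psum; congr (_ + _).
  by apply: eq_bigr => x _; rewrite expr1n mulr1.
elim: M => [|M IH]; first by rewrite big_ord1 big_ord0 uE.
rewrite big_ord_recr IH /= uE; case: ifP => x4.
  have -> : ((M.+1 + 2) %/ 4 = ((M + 2) %/ 4).+1)%N by lia.
  have Mi : M.+1 = (4 * ((M + 2) %/ 4) + 2)%N by lia.
  have fE : freq R ((M + 2) %/ 4) = M.+1%:R by rewrite /freq -Mi.
  rewrite [RHS]big_ord_recr /= fE; congr (_ + _ * _).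
  have -> : M.+1 = (((M + 2) %/ 4).*2.+1).*2 by lia.
  exact: chain_one_sum.
have -> : ((M.+1 + 2) %/ 4 = (M + 2) %/ 4)%N by lia.
by rewrite addr0.
Qed.

(** [p] is the distance of the two raised entries; for [p = 0] both increments fall on the same
    entry and give 3. *)
Lemma rev_e_index n i p : (i.+1 + p <= n)%N ->
  rev (e_index n i.+1 (i.+1 + p)) =
  nseq (n - (i.+1 + p)) 1%N ++ incr_last (nseq p 1%N ++ incr_last (nseq i.+1 1%N)).
Proof.
move=> ipn.
have -> : incr_last (nseq p 1%N ++ incr_last (nseq i.+1 1%N)) =
  if p is p'.+1 then 2%N :: nseq p' 1%N ++ 2%N :: nseq i 1%N else 3%N :: nseq i 1%N.
  by case: p {ipn}.
apply: (@eq_from_nth _ 0%N).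
  rewrite size_rev size_tuple size_cat size_nseq.
  by case: p ipn => [|p] ipn; rewrite /= ?size_cat /= !size_nseq; lia.
move=> j; rewrite size_rev size_tuple => jn.
rewrite nth_rev size_tuple //.
have jn' : (n - j.+1 < n)%N by lia.
have -> : nth 0%N (e_index n i.+1 (i.+1 + p)) (n - j.+1) =
  (1 + ((n - j.+1).+1 == i.+1) + ((n - j.+1).+1 == i.+1 + p))%N.
  by rewrite -[(n - j.+1)%N]/(val (Ordinal jn')) -tnth_nth tnth_mktuple.
rewrite nth_cat size_nseq nth_nseq; case: ifP => [jl|/negbT jl]; first by rewrite jl; lia.
case: p ipn jl {jn'} => [|p] ipn jl.
  case E : (j - _)%N => [|j'] /=; first by lia.
  by rewrite nth_nseq; case: ifP; lia.
case E : (j - _)%N => [|j'] /=; first by lia.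
rewrite nth_cat size_nseq nth_nseq; case: ifP => [jp|/negbT jp]; first by rewrite jp; lia.
case E' : (j' - _)%N => [|j''] /=; first by lia.
by rewrite nth_nseq; case: ifP; lia.
Qed.

End Chains.

(** * Passage to the limit at z = 1 *)

Section Limits.
Variable R : realType.

Lemma cauchy_seq_cvg (u : nat -> R) :
  (forall e, 0 < e -> exists N, forall M K, (N <= M)%N -> (N <= K)%N -> `|u M - u K| <= e) ->
  cvg (u @ \oo).
Proof.
move=> uc; apply/cauchy_cvgP/cauchy_exP => e e0.
have [|N H] := uc (e / 2); first by rewrite divr_gt0.
exists (u N); exists N => // M /= NM; rewrite /ball /=.
by apply: le_lt_trans (H N M (leqnn N) NM) _; lra.
Qed.

(** The Fourier cutoff will count the m_2 = 2 mod 4 up to [M], about a quarter of [M]; hence the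
    4. *)
Lemma small_cvg0 (f : nat -> nat -> R -> R) (K : nat -> nat) : small f ->
  (forall M, (M <= 4 * K M + 4)%N) -> f M (K M) 1 @[M --> \oo] --> (0 : R).
Proof.
move=> fs MK; apply/cvgrPdist_le => e e0; have [N H] := fs e e0.
exists (4 * N + 4)%N => // M /= NM; rewrite sub0r normrN -[leRHS]mulr1; apply: H.
- lia.
- by have := MK M; lia.
- by rewrite ler01 lexx.
Qed.

Lemma partial_tildeT_cvg r (k : r.-tuple nat) : positive_index k ->
  cvg (partial_tildeT R k M @[M --> \oo]).
Proof.
move=> k1; apply: cauchy_seq_cvg => e e0.
have k1' : positive_index (rev k) by rewrite /positive_index all_rev.
have [N H] := @psum_cauchy R _ k1' e e0; exists N => M K NM NK.
rewrite !partial_tildeT_psum; have := H M K NM NK 1; rewrite ler01 lexx mulr1; exact.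
Qed.

Lemma mtv_tildeT_one : mtv_tildeT R [tuple 1%N] = pi / 2.
Proof.
apply/cvg_lim => //; under eq_fun do rewrite partial_tildeT_psum.
have := small_cvg0 (@psum_ones R 1) (K := id).
have idle M : (M <= 4 * M + 4)%N by lia.
move=> /(_ idle) /(cvgD (cvg_cst (pi / 2 : R))); rewrite addr0.
apply: cvg_trans; apply: near_eq_cvg; apply: nearW => M.
by rewrite /= theta1 /dpow expr1 divr1 addrC subrK.
Qed.

End Limits.

Section PartialSums.
Variable R : realType.

Lemma cvg_partial_weighted_sum (c : nat -> R) n :
  \sum_(1 <= m2 < n.+1) c m2 *
      \sum_(m2 <= m1 < n.+1) partial_tildeT R (e_index n m2 m1) M @[M --> \oo] -->
  \sum_(1 <= m2 < n.+1) c m2 *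
      \sum_(m2 <= m1 < n.+1) mtv_tildeT R (e_index n m2 m1).
Proof.
apply: cvg_big => [|m2 _]; first exact: add_continuous.
apply: cvgMl_tmp; apply: cvg_big => [|m1 _]; first exact: add_continuous.
apply: partial_tildeT_cvg; apply/allP => i /tnthP[j ->].
by rewrite tnth_mktuple.
Qed.

Lemma partial_weighted_sumE n M :
  \sum_(1 <= m2 < n.+1) (dumont_count n m2)%:R *
      \sum_(m2 <= m1 < n.+1) partial_tildeT R (e_index n m2 m1) M =
  outer_sum n (dumont_weight R n) M 1.
Proof.
rewrite big_add1 /= big_mkord; apply: eq_bigr => i _; congr (_ * _).
rewrite -{1}[i.+1]add0n big_addn subSn ?ltn_ord // big_mkord.
apply: eq_bigr => p _; have pn : (i.+1 + p <= n)%N by have := ltn_ord p; have := ltn_ord i; lia.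
rewrite addnC partial_tildeT_psum rev_e_index // tail_sum1.
by rewrite subnDA.
Qed.

End PartialSums.

Unset Implicit Arguments.

Theorem theorem2 (R : realType) (k2 : nat) (k2_ge3 : (3 <= k2)%N)
    (k2_odd : odd k2) :
  \sum_(1 <= m2 < k2.+1) (dumont_count k2 m2)%:R *
      \sum_(m2 <= m1 < k2.+1) mtv_tildeT R (e_index k2 m2 m1) =
  mtv_tildeT R [tuple 1%N] * mtv_T R [tuple 1%N; k2] +
  mtv_tildeT R [tuple 1%N] * mtv_tildeT R [tuple 1%N; k2].
Proof.
have cvg_lhs := @cvg_partial_weighted_sum R (fun m => (dumont_count k2 m)%:R) k2.
set lhs := (X in X = _); rewrite -/lhs in cvg_lhs.
have cvg_diff := small_cvg0 (@outer_sum_fourier R k2 k2_odd k2_ge3)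
  (fun M => ltac:(lia) : (M <= 4 * ((M + 2) %/ 4) + 4)%N).
have p0 : pi / 2 != 0 :> R by rewrite gt_eqF // divr_gt0 // pi_gt0.
have cvg_tilde : cvgn (partial_tildeT R [tuple 1%N; k2]).
  by apply: partial_tildeT_cvg; rewrite /positive_index /= andbT; apply: leq_trans k2_ge3.
(* T(1, k2) is not shown to converge beforehand: the identity of partial sums, solved for
   [partial_T], gives convergence and value at once. *)
have cvg_T : (partial_T R [tuple 1%N; k2] M @[M --> \oo] -->
    (pi / 2)^-1 * (lhs - 0) - mtv_tildeT R [tuple 1%N; k2])%classic.
  have -> : partial_T R [tuple 1%N; k2] = fun M => (pi / 2)^-1 *
      (\sum_(1 <= m2 < k2.+1) (dumont_count k2 m2)%:R *
         \sum_(m2 <= m1 < k2.+1) partial_tildeT R (e_index k2 m2 m1) M -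
       (outer_sum k2 (dumont_weight R k2) M 1 - triple_sum k2 ((M + 2) %/ 4) 1)) -
      partial_tildeT R [tuple 1%N; k2] M.
    apply/funext => M.
    by rewrite partial_weighted_sumE subKr triple_sum1 -partial_sumE mulKf // addrK.
  by apply: cvgB => //; apply: cvgMl_tmp; exact: cvgB cvg_lhs cvg_diff.
rewrite mtv_tildeT_one -mulrDr [mtv_T _ _](cvg_lim _ cvg_T) //.
by rewrite subrK subr0 mulVKf.
Qed.
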